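(* Let $V$ be a unital multiplicative partial isometry (MPI) on a finite dimensional Hilbert space $\mathcal H$. Let $A^L$, $\varepsilon|_{A^L}$ and the three mutually commuting actions $\alpha_{01},\alpha_{02},\alpha_{12}$ of $A^L$ on $\mathcal H$ be the data associated to $V$ as described in the context. Then $$V^*V=(\alpha_{12}\otimes\alpha_{02})(e_\varepsilon),\qquad VV^*=(\alpha_{02}\otimes\alpha_{01})(e_\varepsilon),$$ and the restriction $U\colon V^*V(\mathcal H\otimes\mathcal H)\to VV^*(\mathcal H\otimes\mathcal H)$ of $V$ is a pseudo-multiplicative unitary over $(N,\nu)=(A^L,\varepsilon|_{A^L})$ with respect to the actions $(\beta,\alpha,\hat\beta)=(\alpha_{01},\alpha_{02},\alpha_{12})$.
   Context: $\mathcal H$ is a finite dimensional complex Hilbert space, $\mathcal L(\mathcal H)$ the algebra of linear operators on $\mathcal H$, $\mathcal L(\mathcal H)_*$ the space of linear functionals on $\mathcal L(\mathcal H)$. Leg notation: $X_{ij}$ denotes $X\in\mathcal L(\mathcal H\otimes\mathcal H)$ acting on the $i$-th and $j$-th tensor factors (in this order) of $\mathcal H\otimes\mathcal H\otimes\mathcal H$. ${}^*$-homomorphisms into $\mathcal L(\mathcal H)$ are not required to map the unit to $\mathrm{id}_{\mathcal H}$. MPI. A multiplicative partial isometry on $\mathcal H$ is $V\in\mathcal L(\mathcal H\otimes\mathcal H)$ with $VV^*V=V$ and $$V_{23}V_{12}=V_{12}V_{13}V_{23},\quad V_{13}V_{23}V_{23}^*=V_{12}^*V_{12}V_{13},\quad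 V_{12}V_{12}^*V_{23}=V_{23}V_{12}V_{12}^*,\quad V_{12}V_{23}^*V_{23}=V_{23}^*V_{23}V_{12}.$$ Put $\lambda(\omega)=(\omega\otimes\mathrm{id})(V)$, $\rho(\omega)=(\mathrm{id}\otimes\omega)(V)$, $A=\lambda(\mathcal L(\mathcal H)_* )$, $\hat A=\rho(\mathcal L(\mathcal H)_* )$ (subalgebras of $\mathcal L(\mathcal H)$), with the non-degenerate pairing $\langle\lambda(\omega),\rho(\omega')\rangle=(\omega\otimes\omega')(V)$ and coproducts $\Delta(X)=V(X\otimes\mathrm{id})V^*$ on $A$, $\hat\Delta(X)=V^*(\mathrm{id}\otimes X)V$ on $\hat A$. $V$ is unital if there are $\varepsilon,\hat\varepsilon\in\mathcal L(\mathcal H)_*$ such that $\mathbf 1=\lambda(\hat\varepsilon)$ and $\hat{\mathbf 1}=\rho(\varepsilon)$ are two-sided units of $A$ and $\hat A$; $\varepsilon|_A$ and $\hat\varepsilon|_{\hat A}$ are then the counits, and $A,\hat A$ are weak bialgebras in duality. Quasibasis and $e_\psi$. Let $B$ be a finite dimensional $C^*$-algebra and $\psi\colon B\to\mathbb C$ a faithful positive linear functional. Let $\{a_i\}$ be a basis of $B$ and $\{b_i\}$ the dual basis: $\psi(b_ia_j)=\delta_{ij}$. The index of $\psi$ is the positive invertible central element $\mathrm{Ind}\,\psi=\sum_ia_ib_i$. The modular automorphism $\theta_\psi$ is the automorphism of $B$ with $\psi(xy)=\psi(y\theta_\psi(x))$; it is of the form $\theta_\psi(x)=g_\psi xg_\psi^{-1}$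 with $g_\psi\in B$ positive invertible, and $\theta_\psi^{t}(x)=g_\psi^{t}xg_\psi^{-t}$ for real $t$. Put $$e_\psi=\sum_i(\mathrm{Ind}\,\psi)^{-1}a_i\otimes\theta_\psi^{1/2}(b_i).$$ $e_\psi$ is a Hermitean idempotent of $B^{o}\otimes B$ ($B^o$ the opposite algebra), and it is invariant under the flip of the tensor factors. If $\beta\colon B^o\to\mathcal L(\mathcal H)$ and $\gamma\colon B\to\mathcal L(\mathcal K)$ are ${}^*$-homomorphisms (a right, respectively left, action), the relative tensor product $\mathcal H\otimes_\psi\mathcal K$ is the subspace $(\beta\otimes\gamma)(e_\psi)(\mathcal H\otimes\mathcal K)$, and $\mathcal K\otimes_{\psi^o}\mathcal H$ is the subspace $(\gamma\otimes\beta)(e_\psi)(\mathcal K\otimes\mathcal H)$. Pseudo-multiplicative unitary (finite dimensional case). Let $N$ be a finite dimensional $C^*$-algebra, $\nu$ a faithful positive linear functional on $N$, and $\beta\colon N\to\mathcal L(\mathcal H)$, $\alpha\colon N^o\to\mathcal L(\mathcal H)$, $\hat\beta\colon N\to\mathcal L(\mathcal H)$ ${}^*$-homomorphisms with pairwise commuting ranges. Put $\hat E=(\hat\beta\otimes\alpha)(e_\nu)$, $E=(\alpha\otimes\beta)(e_\nu)$. A pseudo-multiplicative unitary is a unitary $U\colon\hat E(\mathcal H\otimes\mathcal H)\to E(\mathcal H\otimes\mathcal H)$ such that (i) for all $x\in N$: $U(\beta(x)\otimes\mathrm{id})=(\beta(x)\otimes\mathrm{id})U$, $U(\mathrm{id}\otimes\beta(x))=(\hat\beta(x)\otimes\mathrm{id})U$,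 $U(\mathrm{id}\otimes\hat\beta(x))=(\mathrm{id}\otimes\hat\beta(x))U$, $U(\alpha(x)\otimes\mathrm{id})=(\mathrm{id}\otimes\alpha(x))U$, as maps on $\hat E(\mathcal H\otimes\mathcal H)$ (each operator preserves the subspace on which it acts); (ii) the pentagon equation holds: as maps $\hat E_{12}\hat E_{23}(\mathcal H^{\otimes3})\to E_{12}E_{23}(\mathcal H^{\otimes3})$, $U_{23}\circ U_{12}=U_{12}\circ\Sigma_{12}\circ U_{23}\circ\Sigma_{12,3}\circ\Sigma_{23}\circ U_{23}$, where $\Sigma_{ij}$ is the flip of factors $i,j$, $\Sigma_{12,3}(\xi\otimes\eta\otimes\zeta)=\zeta\otimes\xi\otimes\eta$, and each factor is restricted to the appropriate subspace; on the left the successive subspaces are $\hat E_{12}\hat E_{23}$, $E_{12}\hat E_{23}$, $E_{12}E_{23}$, and on the right they are $\hat E_{12}\hat E_{23}$, $\hat E_{13}E_{23}$, $\hat E_{12}E_{32}$, $E_{13}\hat E_{23}$, $\hat E_{21}E_{23}$, $E_{13}\hat E_{12}$, $E_{12}E_{23}$ (each applied to $\mathcal H^{\otimes3}$). Data associated to $V$. Let $A^L=\{(\omega\otimes\mathrm{id})(VV^* )\mid\omega\in\mathcal L(\mathcal H)_*\}$ and $A^R=\{(\mathrm{id}\otimes\omega)(VV^* )\mid\omega\in\mathcal L(\mathcal H)_*\}$; these are ${}^*$-subalgebras of $\mathcal L(\mathcal H)$ contained in $A$, and $\varepsilon|_{A^L}$ is a faithful positive functional of index $\mathbf 1$. Let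 $S\colon A^L\to A^R$ be $S(x^L)=\mathbf 1_{(1)}\varepsilon(x^L\mathbf 1_{(2)})$ (where $\Delta(\mathbf 1)=\mathbf 1_{(1)}\otimes\mathbf 1_{(2)}$), let $\theta$ be the modular automorphism of $\varepsilon|_{A^L}$, and let $S_o=S\circ\theta^{-1/2}$. Let $e_\varepsilon$ be the element $e_\psi$ for $\psi=\varepsilon|_{A^L}$. For $x^L\in A^L$ define operators on $\mathcal H$: $$\alpha_{01}(x^L)=x^L,\qquad\alpha_{02}(x^L)=S_o(x^L),\qquad\alpha_{12}(x^L)=x^L\rightharpoonup\hat{\mathbf 1}:=\hat{\mathbf 1}_{(1)}\langle x^L,\hat{\mathbf 1}_{(2)}\rangle,$$ where $\hat\Delta(\hat{\mathbf 1})=\hat{\mathbf 1}_{(1)}\otimes\hat{\mathbf 1}_{(2)}$. Then $\alpha_{01},\alpha_{12}$ are left actions and $\alpha_{02}$ is a right action of $A^L$, and the three commute with each other. *)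

(* Defs.v *)
From HB Require Import structures.
From mathcomp Require Import all_boot all_order all_algebra all_fingroup.
From mathcomp Require Import boolp classical_sets functions reals.
From mathcomp Require Import mxtens complex.

(* Operators on H = C^n are matrices 'M[C]_n acting on column vectors, so that *)
(* X *m Y is the composition "X after Y" and X^t* is the Hilbert space         *)
(* adjoint. Operators on H (x) H are matrices of size n * n, with              *)
(* A *t B = A (x) B; the basis vector e_i (x) e_j has index                    *)
(* mxtens_index (i, j).                                                        *)

Set Implicit Arguments.
Unset Strict Implicit.
Unset Printing Implicit Defensive.

Import GRing.Theory Num.Theory.

#[global] Open Scope ring_scope.
#[global] Open Scope classical_set_scope.
#[global] Open Scope sesquilinear_scope.

Notation "A *t B" := (tensmx A B) (at level 40, left associativity) : ring_scope.

Section TensorLegs.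
Context {C : numClosedFieldType} {n : nat}.

Definition functional := 'Hom('M[C]_n, C^o).

(* (w (x) id)(X) and (id (x) w)(X) *)
Definition slicel (w : 'M[C]_n -> C) (X : 'M[C]_(n * n)) : 'M[C]_n :=
  \matrix_(k, l) w (\matrix_(i, j) X (mxtens_index (i, k)) (mxtens_index (j, l))).
Definition slicer (w : 'M[C]_n -> C) (X : 'M[C]_(n * n)) : 'M[C]_n :=
  \matrix_(i, j) w (\matrix_(k, l) X (mxtens_index (i, k)) (mxtens_index (j, l))).

Lemma slicel_tens (w : functional) (A B : 'M[C]_n) :
  slicel w (A *t B) = w A *: B.
Proof.
apply/matrixP => k l; rewrite !mxE.
transitivity (w (B k l *: A)); last by rewrite linearZ /= mulrC.
by congr (w _); apply/matrixP => i j; rewrite !mxE !mxtens_indexK mulrC.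
Qed.

Lemma slicer_tens (w : functional) (A B : 'M[C]_n) :
  slicer w (A *t B) = w B *: A.
Proof.
apply/matrixP => i j; rewrite !mxE.
transitivity (w (A i j *: B)); last by rewrite linearZ /= mulrC.
by congr (w _); apply/matrixP => k l; rewrite !mxE !mxtens_indexK.
Qed.

(* lambda and rho as linear maps on the space of functionals, so that their    *)
(* images are subspaces (limg) and that they have linear right inverses on     *)
(* their images (_^-1)                                                         *)
Definition lam (X : 'M[C]_(n * n)) : 'Hom(functional, 'M[C]_n) :=
  linfun (fun w : functional => slicel w X).
Definition rho (X : 'M[C]_(n * n)) : 'Hom(functional, 'M[C]_n) :=
  linfun (fun w : functional => slicer w X).

Lemma lamE X (w : functional) : lam X w = slicel w X.
Proof.
have lin : linear (fun w : functional => slicel w X).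
  by move=> c u v; apply/matrixP => k l; rewrite !mxE add_lfunE scale_lfunE.
pose f : {linear functional -> 'M[C]_n} := HB.pack (fun w : functional => slicel w X)
  (GRing.isLinear.Build _ _ _ _ _ lin).
exact: (lfunE f).
Qed.

Lemma rhoE X (w : functional) : rho X w = slicer w X.
Proof.
have lin : linear (fun w : functional => slicer w X).
  by move=> c u v; apply/matrixP => k l; rewrite !mxE add_lfunE scale_lfunE.
pose f : {linear functional -> 'M[C]_n} := HB.pack (fun w : functional => slicer w X)
  (GRing.isLinear.Build _ _ _ _ _ lin).
exact: (lfunE f).
Qed.

Definition f1 : 'I_3 := @Ordinal 3 0 isT.
Definition f2 : 'I_3 := @Ordinal 3 1 isT.
Definition f3 : 'I_3 := @Ordinal 3 2 isT.

(* the index a of the basis vector e_i (x) e_j (x) e_l is sent to (i, j, l) *)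
Definition coord3 (a : 'I_(n * n * n)) : 'I_3 -> 'I_n :=
  let: (ij, l) := mxtens_unindex a in
  let: (i, j) := mxtens_unindex ij in
  tnth [tuple i; j; l].

(* X_{ij} for i != j: the first factor of X acts on the factor i and the       *)
(* second one on the factor j, also when i > j                                 *)
Definition leg (i j : 'I_3) (X : 'M[C]_(n * n)) : 'M[C]_(n * n * n) :=
  \matrix_(a, b)
    (X (mxtens_index (coord3 a i, coord3 a j))
       (mxtens_index (coord3 b i, coord3 b j))
     *+ [forall k, (k != i) && (k != j) ==> (coord3 a k == coord3 b k)]).

(* the k-th factor of the image of x_1 (x) x_2 (x) x_3 is x_(s k) *)
Definition permop (s : 'I_3 -> 'I_3) : 'M[C]_(n * n * n) :=
  \matrix_(a, b) ([forall k, coord3 a k == coord3 b (s k)])%:R.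

Definition flip (i j : 'I_3) := permop (tperm i j).

(* x (x) y (x) z |-> z (x) x (x) y *)
Definition flip12_3 :=
  permop (fun k => if k == f1 then f3 else if k == f2 then f1 else f2).

End TensorLegs.
Arguments functional C n : clear implicits.

Definition ran {C : numClosedFieldType} {m} (P : 'M[C]_m) : set 'cV[C]_m :=
  range (mulmx P).

Definition maps {C : numClosedFieldType} {m} (X : 'M[C]_m)
    (D T : set 'cV[C]_m) : Prop :=
  set_fun D T (mulmx X).

(* Finite dimensional C*-algebras are represented by the *-subalgebras of the  *)
(* 'M[C]_m; their unit is in general not the identity matrix. Linear           *)
(* functionals on B are represented by linear functionals on 'M[C]_m, of which *)
(* only the restriction to B matters. The objects below that are obtained by   *)
(* xget are uniquely determined if B is a *-subalgebra and psi a faithful      *)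
(* positive functional, except for g_psi, which is unique up to a factor in    *)
(* the center of B (and theta_psi^{1/2}, theta_psi^{-1/2} do not depend on     *)
(* this factor).                                                               *)
Section CstarAlgebra.
Context {C : numClosedFieldType} {m : nat}.
Implicit Types (B : {vspace 'M[C]_m}) (psi : functional C m) (x y g : 'M[C]_m).

Definition cstar_alg B : Prop :=
  {in B &, forall x y, x *m y \in B} /\ {in B, forall x, x^t* \in B}.

Definition is_unit_of B e : Prop :=
  e \in B /\ {in B, forall x, e *m x = x /\ x *m e = x}.
Definition unit_of B : 'M[C]_m := xget 0 [set e | is_unit_of B e].

Definition is_inv_in B x y : Prop :=
  [/\ y \in B, x *m y = unit_of B & y *m x = unit_of B].
Definition inv_in B x : 'M[C]_m := xget 0 [set y | is_inv_in B x y].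

Definition pos_in B x : Prop := exists2 y, y \in B & x = y^t* *m y.
Definition sqrt_in B x : 'M[C]_m := xget 0 [set y | pos_in B y /\ y *m y = x].

Definition faithful_positive B psi : Prop :=
  {in B, forall x, 0 <= (psi (x^t* *m x) : C)} /\
  {in B, forall x, psi (x^t* *m x) = 0 -> x = 0}.

(* x |-> g x g^-1 is the modular automorphism of psi *)
Definition is_modular B psi g : Prop :=
  [/\ pos_in B g, exists y, is_inv_in B g y
    & {in B &, forall x y, psi (x *m y) = psi (y *m (g *m x *m inv_in B g))}].
Definition g_ B psi : 'M[C]_m := xget 0 [set g | is_modular B psi g].

Definition theta_half B psi x : 'M[C]_m :=
  let h := sqrt_in B (g_ B psi) in h *m x *m inv_in B h.
Definition theta_mhalf B psi x : 'M[C]_m :=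
  let h := sqrt_in B (g_ B psi) in inv_in B h *m x *m h.

Definition is_dual_basis B psi (b : (\dim B).-tuple 'M[C]_m) : Prop :=
  forall i j : 'I_(\dim B), tnth b i \in B /\
    psi (tnth b i *m tnth (vbasis B) j) = (i == j)%:R.
Definition dual_basis B psi : (\dim B).-tuple 'M[C]_m :=
  xget (vbasis B) [set b | is_dual_basis psi b].

Definition Ind B psi : 'M[C]_m :=
  \sum_i tnth (vbasis B) i *m tnth (dual_basis B psi) i.

(* (f (x) h)(e_psi) for linear maps f, h defined on B *)
Definition e_app {n} B psi (f h : 'M[C]_m -> 'M[C]_n) : 'M[C]_(n * n) :=
  \sum_i f (inv_in B (Ind B psi) *m tnth (vbasis B) i)
         *t h (theta_half B psi (tnth (dual_basis B psi) i)).

Definition linear_on {n} B (f : 'M[C]_m -> 'M[C]_n) : Prop :=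
  forall c, {in B &, forall x y, f (c *: x + y) = c *: f x + f y}.

Definition star_hom {n} B (f : 'M[C]_m -> 'M[C]_n) : Prop :=
  [/\ linear_on B f, {in B &, forall x y, f (x *m y) = f x *m f y}
    & {in B, forall x, f (x^t*) = (f x)^t*}].

(* *-homomorphism from the opposite algebra *)
Definition star_antihom {n} B (f : 'M[C]_m -> 'M[C]_n) : Prop :=
  [/\ linear_on B f, {in B &, forall x y, f (x *m y) = f y *m f x}
    & {in B, forall x, f (x^t*) = (f x)^t*}].

Definition commuting {n} B (f h : 'M[C]_m -> 'M[C]_n) : Prop :=
  {in B &, forall x y, f x *m h y = h y *m f x}.

End CstarAlgebra.

Section PseudoMultiplicativeUnitary.
Context {C : numClosedFieldType} {m n : nat}.

(* U : ran P -> ran Q is unitary *)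
Definition unitary_between (P Q U : 'M[C]_(n * n)) : Prop :=
  [/\ maps U (ran P) (ran Q),
      {in ran P &, forall x y, (U *m x)^t* *m (U *m y) = x^t* *m y}
    & set_surj (ran P) (ran Q) (mulmx U)].

(* U X = Y U as maps on ran P, X and Y preserving ran P and ran Q *)
Definition intertwines (P Q U X Y : 'M[C]_(n * n)) : Prop :=
  [/\ maps X (ran P) (ran P), maps Y (ran Q) (ran Q)
    & {in ran P, forall v, U *m (X *m v) = Y *m (U *m v)}].

(* Only the restriction of the matrix U to ran Eh matters: in the pentagon,    *)
(* each of the factors is required to map the indicated subspace to the next   *)
(* one, hence U_{ij} is only applied to vectors in the range of Eh_{ij}.       *)
Definition pseudo_mult_unitary (N : {vspace 'M[C]_m}) (nu : functional C m)
    (beta alpha betah : 'M[C]_m -> 'M[C]_n) (U : 'M[C]_(n * n)) : Prop :=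
  let Eh := e_app N nu betah alpha in
  let E := e_app N nu alpha beta in
  [/\ cstar_alg N /\ faithful_positive N nu,
      [/\ star_hom N beta, star_antihom N alpha & star_hom N betah],
      [/\ commuting N beta alpha, commuting N beta betah
        & commuting N alpha betah],
      unitary_between Eh E U
    & [/\ {in N, forall x,
            [/\ intertwines Eh E U (beta x *t 1%:M) (beta x *t 1%:M),
                intertwines Eh E U (1%:M *t beta x) (betah x *t 1%:M),
                intertwines Eh E U (1%:M *t betah x) (1%:M *t betah x)
              & intertwines Eh E U (alpha x *t 1%:M) (1%:M *t alpha x)]},
          maps (leg f1 f2 U) (ran (leg f1 f2 Eh *m leg f2 f3 Eh))
                             (ran (leg f1 f2 E *m leg f2 f3 Eh))
          /\ maps (leg f2 f3 U) (ran (leg f1 f2 E *m leg f2 f3 Eh))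
                                (ran (leg f1 f2 E *m leg f2 f3 E)),
          [/\ maps (leg f2 f3 U) (ran (leg f1 f2 Eh *m leg f2 f3 Eh))
                                 (ran (leg f1 f3 Eh *m leg f2 f3 E)),
              maps (flip f2 f3) (ran (leg f1 f3 Eh *m leg f2 f3 E))
                                (ran (leg f1 f2 Eh *m leg f3 f2 E))
            & maps flip12_3 (ran (leg f1 f2 Eh *m leg f3 f2 E))
                            (ran (leg f1 f3 E *m leg f2 f3 Eh))],
          [/\ maps (leg f2 f3 U) (ran (leg f1 f3 E *m leg f2 f3 Eh))
                                 (ran (leg f2 f1 Eh *m leg f2 f3 E)),
              maps (flip f1 f2) (ran (leg f2 f1 Eh *m leg f2 f3 E))
                                (ran (leg f1 f3 E *m leg f1 f2 Eh))
            & maps (leg f1 f2 U) (ran (leg f1 f3 E *m leg f1 f2 Eh))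
                                 (ran (leg f1 f2 E *m leg f2 f3 E))]
        & {in ran (leg f1 f2 Eh *m leg f2 f3 Eh), forall v,
            leg f2 f3 U *m (leg f1 f2 U *m v) =
            leg f1 f2 U *m (flip f1 f2 *m (leg f2 f3 U *m
              (flip12_3 *m (flip f2 f3 *m (leg f2 f3 U *m v)))))}]].

End PseudoMultiplicativeUnitary.

Section MultiplicativePartialIsometry.
Context {C : numClosedFieldType} {n : nat}.
Implicit Types (V : 'M[C]_(n * n)) (eps epsh w : functional C n).

Definition mult_partial_isometry V : Prop :=
  let V12 := leg f1 f2 V in let V13 := leg f1 f3 V in
  let V23 := leg f2 f3 V in
  V *m V^t* *m V = V /\
  [/\ V23 *m V12 = V12 *m V13 *m V23,
      V13 *m V23 *m V23^t* = V12^t* *m V12 *m V13,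
      V12 *m V12^t* *m V23 = V23 *m V12 *m V12^t*
    & V12 *m V23^t* *m V23 = V23^t* *m V23 *m V12].

Definition A_ V : {vspace 'M[C]_n} := limg (lam V).
Definition Ahat V : {vspace 'M[C]_n} := limg (rho V).

Definition unital V eps epsh : Prop :=
  is_unit_of (A_ V) (lam V epsh) /\ is_unit_of (Ahat V) (rho V eps).

(* <x, y> for x = lambda(w) in A and y = rho(w') in Ahat, which does not       *)
(* depend on the choice of w and w'; (w (x) w')(V) = w'(lambda(w))             *)
Definition pairing V (x y : 'M[C]_n) : C :=
  let w := ((lam V)^-1)%VF x in let w' := ((rho V)^-1)%VF y in
  w' (slicel w V).

Definition Delta V (X : 'M[C]_n) : 'M[C]_(n * n) := V *m (X *t 1%:M) *m V^t*.
Definition Deltah V (X : 'M[C]_n) : 'M[C]_(n * n) := V^t* *m (1%:M *t X) *m V.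

Definition AL V : {vspace 'M[C]_n} := limg (lam (V *m V^t*)).

Definition S_ V eps epsh (x : 'M[C]_n) : 'M[C]_n :=
  slicer (fun y => eps (x *m y)) (Delta V (lam V epsh)).

Definition alpha01 (x : 'M[C]_n) : 'M[C]_n := x.
Definition alpha02 V eps epsh (x : 'M[C]_n) : 'M[C]_n :=
  S_ V eps epsh (theta_mhalf (AL V) eps x).
Definition alpha12 V eps (x : 'M[C]_n) : 'M[C]_n :=
  slicer (pairing V x) (Deltah V (rho V eps)).

End MultiplicativePartialIsometry.

(* Main.v *)
From HB Require Import structures.
Require Import Defs.
From mathcomp Require Import all_boot all_order all_algebra fingroup perm.
From mathcomp Require Import classical_sets reals.
From mathcomp Require Import mxtens complex ring.

Set Implicit Arguments.
Unset Strict Implicit.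
Unset Printing Implicit Defensive.

Import GRing.Theory Num.Theory.

(** Write P = V V^*, Q = V^* V, and let e be the unit of A.

Applying functionals to the three legs turns the axioms and their consequences
V12 V13 = V23 V12 V23^*, V13 V23 = V12^* V23 V12, V12 P13 = P23 V12 and
V23 Q12 = Q13 V23 into identities between slices of V, P and Q. They show that
A^L is contained in A, that e is Hermitian and is also the unit of the dual
algebra Ahat ([adj_unit], [counith_unit]), hence that Delta(e) = P, and they contain
all intertwining relations of V ([V_xll], [V_xlr], [V_qrr], [V_prl]).

The heart of the proof is [S_mulP]: (1 (x) x) P = (S(x) (x) 1) P for x in A^L.
It makes S anti-multiplicative. Let z = (Tr (x) id)(P), a positive invertible
element of A^L. Moving x through P gives eps(x z x^* ) = Tr(S(x) S(x)^* ), so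
eps is positive and faithful on A^L, and eps(x z) = Tr(S(x)), which is a trace;
hence z^{-1} implements the modular automorphism theta ([eps_faithful_positive],
[eps_modular_ex]). With dual bases, P is the sum of the S(b_i) (x) a_i, and
P P = P forces the index to be e ([index_eps]). Expanding P in the basis
theta^{1/2}(b_i) instead gives the formula for P ([finalp_e_app]); applying
alpha12, which sends a slice of P to the slice of Q at the same functional,
gives the one for Q ([initialp_e_app]). Finally S(x^* )^* = S(theta^{-1}(x)), so
S theta^{-1/2} preserves adjoints ([alpha02_star_antihom]).

The subspaces in the pentagon are ranges of products of two commuting legs of P
and Q, and each factor maps one to the next by a leg identity. The flips turn
the V23 between them into V13 ([pentagon_flips]).

Square roots inside A^L come from the spectral theorem: a function of a
Hermitian matrix that vanishes at 0 is a polynomial in it without constant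
term, and so stays in every algebra containing the matrix. *)

(** * Adjoints and elementary tensors *)

Section Tensors.
Context {C : numClosedFieldType}.

Lemma adjM m1 m2 m3 (A : 'M[C]_(m1, m2)) (B : 'M[C]_(m2, m3)) :
  (A *m B)^t* = B^t* *m A^t*.
Proof. by rewrite trmx_mul map_mxM. Qed.

Lemma adjD m1 m2 (A B : 'M[C]_(m1, m2)) : (A + B)^t* = A^t* + B^t*.
Proof. by rewrite !raddfD. Qed.

Lemma adjmx1 m : (1%:M : 'M[C]_m)^t* = 1%:M.
Proof. by rewrite trmx1 map_mx1. Qed.

Lemma adjZ m1 m2 c (A : 'M[C]_(m1, m2)) : (c *: A)^t* = c^* *: A^t*.
Proof. by apply/matrixP=> i j; rewrite !mxE rmorphM. Qed.

Lemma adj_tens m1 m2 m3 m4 (A : 'M[C]_(m1, m2)) (B : 'M[C]_(m3, m4)) :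
  (A *t B)^t* = A^t* *t B^t*.
Proof. by rewrite trmx_tens map_mxT. Qed.

Context {n : nat}.
Implicit Types (A B : 'M[C]_n) (X Y : 'M[C]_(n * n)) (w : functional C n).

(** Elementary tensors span, so an identity that is additive in an operator on
the tensor square has to be checked on them only. *)
Lemma tens_ind (K : 'M[C]_(n * n) -> Prop) :
  (forall A B, K (A *t B)) -> (forall X Y, K X -> K Y -> K (X + Y)) ->
  forall X, K X.
Proof.
move=> Kt KD X.
have K0 : K 0 by rewrite -(tens0mx (m:=n) (n:=n) (0 : 'M[C]_n)); apply: Kt.
rewrite (matrix_sum_delta X).
elim/big_ind: _ => // a _; elim/big_ind: _ => // b _.
move: (X a b) => c; case: (mxtens_indexP a) => i k; case: (mxtens_indexP b) => j l.
suff -> : c *: delta_mx (mxtens_index (i, k)) (mxtens_index (j, l)) =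
  (c *: delta_mx i j) *t delta_mx k l by exact: Kt.
apply/matrixP=> a' b'; case: (mxtens_indexP a') => i' k'.
case: (mxtens_indexP b') => j' l'; rewrite tensmxE !mxE.
rewrite !(inj_eq (can_inj (@mxtens_indexK _ _))) !xpair_eqE -mulrA -natrM mulnb.
by congr (_ * _%:R); rewrite andbACA.
Qed.

Lemma tensDl A A' B : (A + A') *t B = A *t B + A' *t B.
Proof. by apply/matrixP=> i j; rewrite !mxE mulrDl. Qed.

Lemma tensDr A B B' : A *t (B + B') = A *t B + A *t B'.
Proof. by apply/matrixP=> i j; rewrite !mxE mulrDr. Qed.

Lemma tensZr c A B : A *t (c *: B) = c *: (A *t B).
Proof. by apply/matrixP=> i j; rewrite !mxE mulrCA. Qed.

Lemma tens_comm A B : (A *t 1%:M) *m (1%:M *t B) = (1%:M *t B) *m (A *t 1%:M).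
Proof. by rewrite !tensmx_mul !mulmx1 !mul1mx. Qed.

(** * Legs of the triple tensor product *)

Definition idx3 (i j l : 'I_n) : 'I_(n * n * n) :=
  mxtens_index (mxtens_index (i, j), l).

Lemma idx3P (a : 'I_(n * n * n)) :
  a = idx3 (coord3 a f1) (coord3 a f2) (coord3 a f3).
Proof.
case: (mxtens_indexP a) => ij l; case: (mxtens_indexP ij) => i j.
by rewrite /coord3 !mxtens_indexK.
Qed.

Lemma coord3K i j l :
  (coord3 (idx3 i j l) f1 = i) * (coord3 (idx3 i j l) f2 = j)
  * (coord3 (idx3 i j l) f3 = l).
Proof. by rewrite /coord3 !mxtens_indexK. Qed.

Lemma forall3 (p : pred 'I_3) : [forall k, p k] = [&& p f1, p f2 & p f3].
Proof.
apply/forallP/and3P => [H|[H1 H2 H3]]; first by split.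
case=> [[|[|[|//]]] lt3].
- by move: H1; congr (is_true (p _)); apply: val_inj.
- by move: H2; congr (is_true (p _)); apply: val_inj.
- by move: H3; congr (is_true (p _)); apply: val_inj.
Qed.

Lemma coord3_inj (a b : 'I_(n * n * n)) :
  (forall k, coord3 a k = coord3 b k) -> a = b.
Proof. by move=> H; rewrite (idx3P a) (idx3P b) !H. Qed.

Lemma tens3E A1 A2 A3 a b :
  (A1 *t A2 *t A3) a b = A1 (coord3 a f1) (coord3 b f1)
    * A2 (coord3 a f2) (coord3 b f2) * A3 (coord3 a f3) (coord3 b f3).
Proof. by rewrite {1}(idx3P a) {1}(idx3P b) /idx3 !tensmxE. Qed.

Lemma leg12_tens A B : leg f1 f2 (A *t B) = A *t B *t 1%:M.
Proof.
apply/matrixP=> a b; rewrite tens3E mxE tensmxE forall3 /= !mxE.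
by rewrite mulr_natr.
Qed.

Lemma leg13_tens A B : leg f1 f3 (A *t B) = A *t 1%:M *t B.
Proof.
apply/matrixP=> a b; rewrite tens3E mxE tensmxE forall3 /= andbT !mxE.
by rewrite mulr_natr -mulrnAl.
Qed.

Lemma leg23_tens A B : leg f2 f3 (A *t B) = 1%:M *t A *t B.
Proof.
apply/matrixP=> a b; rewrite tens3E mxE tensmxE forall3 /= andbT !mxE.
by rewrite mulr_natl -mulrnAl.
Qed.

Lemma legD i j X Y : leg i j (X + Y) = leg i j X + leg i j Y.
Proof. by apply/matrixP=> a b; rewrite !mxE mulrnDl. Qed.

Definition reidx (s : 'I_3 -> 'I_3) (a : 'I_(n * n * n)) :=
  idx3 (coord3 a (s f1)) (coord3 a (s f2)) (coord3 a (s f3)).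

Lemma coord3_reidx s a k : coord3 (reidx s a) k = coord3 a (s k).
Proof.
have [] : [forall k, coord3 (reidx s a) k == coord3 a (s k)].
  by rewrite forall3 /reidx !coord3K !eqxx.
by move=> /forallP /(_ k) /eqP.
Qed.

Lemma permopE (s : 'I_3 -> 'I_3) a b :
  (permop s : 'M[C]_(n * n * n)) a b = (a == reidx s b)%:R.
Proof.
rewrite mxE; congr (_%:R); congr (nat_of_bool _).
apply/forallP/eqP => [H|-> k]; last by rewrite coord3_reidx.
by apply: coord3_inj => k; rewrite coord3_reidx; apply/eqP.
Qed.

Section Permop.
Context (s t : 'I_3 -> 'I_3) (sK : cancel s t) (tK : cancel t s).

Lemma permopE' a b : (permop s : 'M[C]_(n * n * n)) a b = (b == reidx t a)%:R.
Proof.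
rewrite permopE; congr (_%:R); congr (nat_of_bool _).
by apply/eqP/eqP => ->; apply: coord3_inj => k; rewrite !coord3_reidx ?sK ?tK.
Qed.

Lemma mul_permop m (M : 'M[C]_(_, m)) a b :
  (permop s *m M) a b = M (reidx t a) b.
Proof.
rewrite mxE (bigD1 (reidx t a)) //= permopE' eqxx mul1r big1 ?addr0 // => c.
by rewrite permopE' => /negPf ->; rewrite mul0r.
Qed.

Lemma mulmx_permop m (M : 'M[C]_(m, _)) a b :
  (M *m permop s) a b = M a (reidx s b).
Proof.
rewrite mxE (bigD1 (reidx s b)) //= permopE eqxx mulr1 big1 ?addr0 // => c.
by rewrite permopE => /negPf ->; rewrite mulr0.
Qed.

Lemma permopK : (permop s : 'M[C]_(n * n * n)) *m permop t = 1%:M.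
Proof.
apply/matrixP=> a b; rewrite mul_permop permopE mxE; congr (_%:R).
congr (nat_of_bool _); apply/eqP/eqP=> [H|->//].
apply: coord3_inj => k.
by move: (f_equal (fun x => coord3 x (s k)) H); rewrite !coord3_reidx sK.
Qed.

Lemma permop_leg i j X :
  permop s *m leg i j X = leg (t i) (t j) X *m permop s.
Proof.
apply/matrixP=> a b; rewrite mul_permop mulmx_permop !mxE !coord3_reidx !tK.
congr (_ *+ _); congr (nat_of_bool _); apply/forallP/forallP => H k.
  move: (H (s k)); rewrite !coord3_reidx sK.
  by rewrite (can2_eq sK tK) (can2_eq sK tK).
move: (H (t k)); rewrite !coord3_reidx tK.
by rewrite (can2_eq tK sK) (can2_eq tK sK) !tK.
Qed.

Lemma adj_permop : (permop s)^t* = permop t :> 'M[C]_(n * n * n).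
Proof.
by apply/matrixP=> a b; rewrite 2!mxE permopE' permopE rmorph_nat.
Qed.

End Permop.

Lemma permop_comp (s s' t : 'I_3 -> 'I_3) : cancel s t -> cancel t s ->
  permop s *m permop s' = permop (s' \o s) :> 'M[C]_(n * n * n).
Proof.
move=> sK tK; apply/matrixP=> a b; rewrite (mul_permop sK tK) !mxE.
congr (_%:R); congr (nat_of_bool _); apply/forallP/forallP => H k /=.
  by move: (H (s k)); rewrite coord3_reidx sK.
by move: (H (t k)); rewrite coord3_reidx /= tK.
Qed.

(** A permutation carrying the legs 1 and 2 to i and j. *)
Let legperm (i j : 'I_3) : {perm 'I_3} :=
  (tperm f2 (tperm f1 i j) * tperm f1 i)%g.

(** Conjugation by a permutation of the factors reduces every pair of legs to
the first two, where [leg] is a tensor product with the identity; this makes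
[leg i j] a *-homomorphism. *)
Lemma leg_conj i j X : i != j -> let t := legperm i j in
  leg i j X = permop (t^-1)%g *m leg f1 f2 X *m permop t.
Proof.
move=> neq_ij t.
have t1 : t f1 = i.
  rewrite permM (tpermD (x:=f2)) ?tpermL //; apply: contraNneq neq_ij.
  by move=> /(canRL (tpermK _ _)); rewrite tpermL => ->.
have t2 : t f2 = j by rewrite permM tpermL tpermK.
rewrite (permop_leg (permKV t) (permK t)) -mulmxA.
by rewrite (permopK (permKV t) (permK t)) mulmx1 t1 t2.
Qed.

Lemma leg12E X : leg f1 f2 X = X *t 1%:M.
Proof.
elim/tens_ind: X => [A B|X Y hX hY]; first exact: leg12_tens.
by rewrite legD hX hY; apply/matrixP=> a b; rewrite !mxE mulrDl.
Qed.

Lemma legM i j X Y : i != j -> leg i j X *m leg i j Y = leg i j (X *m Y).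
Proof.
move=> ij; rewrite !(leg_conj _ ij) /= -!mulmxA (mulmxA (permop _) (permop _)).
rewrite (permopK (permK _) (permKV _)) mul1mx; congr (_ *m _).
by rewrite !mulmxA !leg12E tensmx_mul mul1mx.
Qed.

Lemma leg_adj i j X : i != j -> (leg i j X)^t* = leg i j (X^t*).
Proof.
move=> ij; rewrite !(leg_conj _ ij) /= !adjM !mulmxA.
rewrite (adj_permop (permK _) (permKV _)) (adj_permop (permKV _) (permK _)).
by rewrite !leg12E adj_tens adjmx1.
Qed.

End Tensors.
Arguments tens_ind [C n].

(** * Slices and functionals *)

Section Slices.
Context {C : numClosedFieldType} {n : nat}.
Implicit Types (A B : 'M[C]_n) (X Y Z : 'M[C]_(n * n)) (w : functional C n).

Definition functional_of (f : 'M[C]_n -> C)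
    (lin : forall c x y, f (c *: x + y) = c * f x + f y) : functional C n :=
  linfun (HB.pack_for {linear 'M[C]_n -> C^o} (f : 'M[C]_n -> C^o)
    (GRing.isLinear.Build C 'M[C]_n C^o _ f lin)).

Lemma functional_ofE f lin x : @functional_of f lin x = f x.
Proof. by rewrite /functional_of lfunE. Qed.

Lemma functionalD w A B : w (A + B) = w A + w B.
Proof. exact: linearD. Qed.

Lemma functionalZ w c A : w (c *: A) = c * w A.
Proof. exact: linearZ. Qed.

Lemma functional_sum w (I : finType) (F : I -> 'M[C]_n) :
  w (\sum_i F i) = \sum_i w (F i).
Proof. exact: linear_sum. Qed.

Lemma functional_lin w c A B : w (c *: A + B) = c * w A + w B.
Proof. by rewrite functionalD functionalZ. Qed.

Definition mulfl B w : functional C n.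
Proof.
apply: (@functional_of (fun y => w (B *m y))) => c x y.
by rewrite mulmxDr -scalemxAr functional_lin.
Defined.

Definition mulfr B w : functional C n.
Proof.
apply: (@functional_of (fun y => w (y *m B))) => c x y.
by rewrite mulmxDl -scalemxAl functional_lin.
Defined.

Definition coordf (i j : 'I_n) : functional C n.
Proof.
by apply: (@functional_of (fun y : 'M[C]_n => y i j)) => c x y; rewrite !mxE.
Defined.

Definition conjf w : functional C n.
Proof.
apply: (@functional_of (fun y => (w (y^t*) : C)^*)) => c x y.
by rewrite adjD adjZ functional_lin rmorphD rmorphM /= conjCK.
Defined.

Definition tracef : functional C n.
Proof.
apply: (@functional_of (fun y : 'M[C]_n => \tr y)) => c x y.
by rewrite linearP.
Defined.

Lemma mulflE B w x : mulfl B w x = w (B *m x).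
Proof. exact: functional_ofE. Qed.
Lemma mulfrE B w x : mulfr B w x = w (x *m B).
Proof. exact: functional_ofE. Qed.
Lemma coordfE i j x : coordf i j x = x i j.
Proof. exact: functional_ofE. Qed.
Lemma conjfE w x : conjf w x = (w (x^t*) : C)^*.
Proof. exact: functional_ofE. Qed.
Lemma tracefE x : tracef x = \tr x.
Proof. exact: functional_ofE. Qed.

Lemma conjfK w : conjf (conjf w) = w.
Proof. by apply/lfunP=> x; rewrite !conjfE trmxCK /= conjCK. Qed.

Lemma functional_sep A B : (forall w, w A = w B) -> A = B.
Proof.
by move=> H; apply/matrixP=> i j; have := H (coordf i j); rewrite !coordfE.
Qed.

Lemma slicelD w X Y : slicel w (X + Y) = slicel w X + slicel w Y.
Proof.
apply/matrixP=> k l; rewrite !mxE -functionalD; congr (w _).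
by apply/matrixP=> i j; rewrite !mxE.
Qed.

Lemma slicelZ w c X : slicel w (c *: X) = c *: slicel w X.
Proof.
apply/matrixP=> k l; rewrite !mxE -functionalZ; congr (w _).
by apply/matrixP=> i j; rewrite !mxE.
Qed.

Lemma slicerZ w c X : slicer w (c *: X) = c *: slicer w X.
Proof.
apply/matrixP=> k l; rewrite !mxE -functionalZ; congr (w _).
by apply/matrixP=> i j; rewrite !mxE.
Qed.

Lemma slicel0 w : slicel w 0 = 0.
Proof. by rewrite -(scale0r 0) slicelZ scale0r. Qed.

Lemma slicerD w X Y : slicer w (X + Y) = slicer w X + slicer w Y.
Proof.
apply/matrixP=> k l; rewrite !mxE -functionalD; congr (w _).
by apply/matrixP=> i j; rewrite !mxE.
Qed.

Lemma slicel_sum w (I : finType) (F : I -> 'M[C]_(n * n)) :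
  slicel w (\sum_i F i) = \sum_i slicel w (F i).
Proof. exact: (big_morph _ (slicelD w) (slicel0 w)). Qed.

Lemma slicer0 w : slicer w 0 = 0.
Proof. by rewrite -(scale0r 0) slicerZ scale0r. Qed.

Lemma slicer_sum w (I : finType) (F : I -> 'M[C]_(n * n)) :
  slicer w (\sum_i F i) = \sum_i slicer w (F i).
Proof. exact: (big_morph _ (slicerD w) (slicer0 w)). Qed.

(** Both sides are (w1 (x) w2)(X). *)
Lemma slice_swap w1 w2 X : w1 (slicer w2 X) = w2 (slicel w1 X).
Proof.
elim/tens_ind: X => [A B|X Y hX hY].
  by rewrite slicel_tens slicer_tens !functionalZ mulrC.
by rewrite slicelD slicerD !functionalD hX hY.
Qed.

Lemma slicel_sep X Y : (forall w, slicel w X = slicel w Y) -> X = Y.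
Proof.
move=> H; apply/matrixP=> a b; case: (mxtens_indexP a) => i k.
case: (mxtens_indexP b) => j l.
by have /matrixP /(_ k l) := H (coordf i j); rewrite !mxE !coordfE !mxE.
Qed.

Lemma slicer_sep X Y : (forall w, slicer w X = slicer w Y) -> X = Y.
Proof.
move=> H; apply: slicel_sep => w; apply: functional_sep => w2.
by rewrite -!slice_swap H.
Qed.

Ltac pure_tensors X := let hX := fresh in let hY := fresh in
  elim/tens_ind: X => [? ?|? ? hX hY];
  [rewrite ?(tensmx_mul, slicel_tens, slicer_tens) ?(mulfrE, mulflE, mulmx1, mul1mx)
     -?scalemxAl -?scalemxAr //
  |by rewrite ?(mulmxDl, mulmxDr, slicelD, slicerD) ?hX ?hY].

Lemma slicel_mulr w X B : slicel w (X *m (1%:M *t B)) = slicel w X *m B.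
Proof. by pure_tensors X. Qed.

Lemma slicel_mull w X B : slicel w ((1%:M *t B) *m X) = B *m slicel w X.
Proof. by pure_tensors X. Qed.

Lemma slicer_mulr w X A : slicer w (X *m (A *t 1%:M)) = slicer w X *m A.
Proof. by pure_tensors X. Qed.

Lemma slicer_mull w X A : slicer w ((A *t 1%:M) *m X) = A *m slicer w X.
Proof. by pure_tensors X. Qed.

Lemma slicel_mulfr w X A : slicel w (X *m (A *t 1%:M)) = slicel (mulfr A w) X.
Proof. by pure_tensors X. Qed.

Lemma slicel_mulfl w X A : slicel w ((A *t 1%:M) *m X) = slicel (mulfl A w) X.
Proof. by pure_tensors X. Qed.

Lemma slicer_mulfl w X B : slicer w ((1%:M *t B) *m X) = slicer (mulfl B w) X.
Proof. by pure_tensors X. Qed.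

Lemma slicel_adj w X : slicel w (X^t*) = (slicel (conjf w) X)^t*.
Proof.
elim/tens_ind: X => [A B|X Y hX hY].
  by rewrite adj_tens !slicel_tens adjZ conjfE conjCK.
by rewrite adjD !slicelD adjD hX hY.
Qed.

Lemma slicer_adj w X : slicer w (X^t*) = (slicer (conjf w) X)^t*.
Proof.
elim/tens_ind: X => [A B|X Y hX hY].
  by rewrite adj_tens !slicer_tens adjZ conjfE conjCK.
by rewrite adjD !slicerD adjD hX hY.
Qed.

(** The scalar (w1 (x) w2 (x) w3)(T). *)
Definition slice3 (w1 w2 w3 : functional C n) (T : 'M[C]_(n * n * n)) : C :=
  w1 (\matrix_(i, i') w2 (\matrix_(j, j') w3 (\matrix_(l, l')
    T (idx3 i j l) (idx3 i' j' l')))).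

Lemma slice3_tens w1 w2 w3 A B D :
  slice3 w1 w2 w3 (A *t B *t D) = w1 A * w2 B * w3 D.
Proof.
rewrite /slice3.
have -> : w1 A * w2 B * w3 D = w1 ((w2 B * w3 D) *: A).
  by rewrite functionalZ [RHS]mulrC mulrA.
congr (w1 _); apply/matrixP=> i i'; rewrite [LHS]mxE [RHS]mxE.
have -> : w2 B * w3 D * A i i' = w2 ((A i i' * w3 D) *: B).
  by rewrite functionalZ [RHS]mulrC mulrA mulrAC.
congr (w2 _); apply/matrixP=> j j'; rewrite [LHS]mxE [RHS]mxE.
have -> : A i i' * w3 D * B j j' = w3 ((A i i' * B j j') *: D).
  by rewrite functionalZ mulrAC.
by congr (w3 _); apply/matrixP=> l l'; rewrite [LHS]mxE !tensmxE mxE.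
Qed.

Lemma slice3D w1 w2 w3 T T' :
  slice3 w1 w2 w3 (T + T') = slice3 w1 w2 w3 T + slice3 w1 w2 w3 T'.
Proof.
rewrite /slice3 -functionalD; congr (w1 _); apply/matrixP=> i i'; rewrite !mxE -functionalD.
congr (w2 _); apply/matrixP=> j j'; rewrite !mxE -functionalD; congr (w3 _).
by apply/matrixP=> l l'; rewrite !mxE.
Qed.

End Slices.

(** * Slices of products of legs *)

Section SliceLegs.
Context {C : numClosedFieldType} {n : nat}.
Implicit Types (X Y Z : 'M[C]_(n * n)) (w : functional C n).

(* Reduces a goal that is additive in X to elementary tensors. *)
Ltac additive X := let hX := fresh in let hY := fresh in
  elim/tens_ind: X => [? ?|? ? hX hY];
  [|by rewrite ?(legD, slicelD, slicerD) ?(mulmxDl, mulmxDr) ?(legD, slicelD, slicerD)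
       ?(tensDl, tensDr) ?(mulmxDl, mulmxDr) ?(slice3D, slicelD, slicerD) ?functionalD ?hX ?hY].

Ltac pure3 := rewrite ?(leg12_tens, leg13_tens, leg23_tens) !tensmx_mul
  ?(mul1mx, mulmx1) ?(slicel_tens, slicer_tens) -?scalemxAl -?scalemxAr.

Ltac slice3_by_pure X Y := by additive X; additive Y; pure3;
  rewrite slice3_tens !functionalZ; ring.

(** The leg on which both operators act carries the product of their slices.
Rules of this kind turn an identity between products of legs into a family of
identities between slices, because product functionals separate operators. *)
Lemma slice3_12_13 w1 w2 w3 X Y :
  slice3 w1 w2 w3 (leg f1 f2 X *m leg f1 f3 Y)
  = w1 (slicer w2 X *m slicer w3 Y).
Proof. slice3_by_pure X Y. Qed.

Lemma slice3_12_23 w1 w2 w3 X Y :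
  slice3 w1 w2 w3 (leg f1 f2 X *m leg f2 f3 Y)
  = w2 (slicel w1 X *m slicer w3 Y).
Proof. slice3_by_pure X Y. Qed.

Lemma slice3_23_12 w1 w2 w3 X Y :
  slice3 w1 w2 w3 (leg f2 f3 X *m leg f1 f2 Y)
  = w2 (slicer w3 X *m slicel w1 Y).
Proof. slice3_by_pure X Y. Qed.

Lemma slice3_13_23 w1 w2 w3 X Y :
  slice3 w1 w2 w3 (leg f1 f3 X *m leg f2 f3 Y)
  = w3 (slicel w1 X *m slicel w2 Y).
Proof. slice3_by_pure X Y. Qed.

Lemma slice3_23_12_23 w1 w2 w3 X Y Z :
  slice3 w1 w2 w3 (leg f2 f3 X *m leg f1 f2 Y *m leg f2 f3 Z)
  = w2 (slicer w3 (X *m (slicel w1 Y *t 1%:M) *m Z)).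
Proof.
additive X; additive Y; additive Z; pure3.
rewrite ?(tensmx_mul, mulmx1, slicer_tens) -?(scalemxAr, scalemxAl) slice3_tens.
by rewrite !functionalZ; ring.
Qed.

Lemma slice3_12_23_12 w1 w2 w3 X Y Z :
  slice3 w1 w2 w3 (leg f1 f2 X *m leg f2 f3 Y *m leg f1 f2 Z)
  = w2 (slicel w1 (X *m (1%:M *t slicer w3 Y) *m Z)).
Proof.
additive X; additive Y; additive Z; pure3.
rewrite ?(tensmx_mul, mulmx1, slicel_tens) -?(scalemxAr, scalemxAl) slice3_tens.
by rewrite !functionalZ; ring.
Qed.

End SliceLegs.

(** * Initial and final projections *)

Section PartialIsometry.
Context {C : numClosedFieldType} {m : nat}.
Implicit Types V : 'M[C]_m.

Definition finalp V := V *m V^t*.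
Definition initialp V := V^t* *m V.

Lemma adj_finalp V : (finalp V)^t* = finalp V.
Proof. by rewrite /finalp adjM trmxCK. Qed.

Lemma adj_initialp V : (initialp V)^t* = initialp V.
Proof. by rewrite /initialp adjM trmxCK. Qed.

Context V (Vpi : V *m V^t* *m V = V).

Lemma mul_finalp : finalp V *m V = V.
Proof. exact: Vpi. Qed.

Lemma mul_initialp : V *m initialp V = V.
Proof. by rewrite /initialp mulmxA. Qed.

Lemma initialp_adj : initialp V *m V^t* = V^t*.
Proof. by rewrite -{1}adj_initialp -adjM mul_initialp. Qed.

Lemma finalp_idem : finalp V *m finalp V = finalp V.
Proof. by rewrite {2}/finalp mulmxA mul_finalp. Qed.

Lemma initialp_idem : initialp V *m initialp V = initialp V.
Proof. by rewrite {1}/initialp -mulmxA mul_initialp. Qed.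

End PartialIsometry.

(** * Leg identities of a multiplicative partial isometry *)

Section MPI.
Context {C : numClosedFieldType} {n : nat} (V : 'M[C]_(n * n)).
Context (mpi : mult_partial_isometry V).
Implicit Types (w : functional C n).

Local Notation P := (finalp V).
Local Notation Q := (initialp V).
Local Notation l12 := (leg f1 f2).
Local Notation l13 := (leg f1 f3).
Local Notation l23 := (leg f2 f3).

Lemma mpi_partial : V *m V^t* *m V = V.
Proof. by case: mpi. Qed.
Let Vpi := mpi_partial.

Lemma mpi_pentagon : l23 V *m l12 V = l12 V *m l13 V *m l23 V.
Proof. by case: mpi => _ []. Qed.

Lemma mpi_V13P23 : l13 V *m l23 P = l12 Q *m l13 V.
Proof. by case: mpi => _ [_ + _ _]; rewrite !leg_adj // -mulmxA !legM. Qed.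

Lemma mpi_P12V23 : l12 P *m l23 V = l23 V *m l12 P.
Proof. by case: mpi => _ [_ _ + _]; rewrite !leg_adj // -[RHS]mulmxA !legM. Qed.

Lemma mpi_V12Q23 : l12 V *m l23 Q = l23 Q *m l12 V.
Proof. by case: mpi => _ [_ _ _]; rewrite !leg_adj // -[LHS]mulmxA !legM. Qed.

Lemma mpi_P12P23 : l12 P *m l23 P = l23 P *m l12 P.
Proof.
have H := mpi_P12V23; have /(f_equal (fun X => X^t*)) := H.
rewrite !adjM !leg_adj // adj_finalp => H'.
by rewrite -[l23 P]legM // mulmxA H -!mulmxA H'.
Qed.

Lemma mpi_Q12Q23 : l12 Q *m l23 Q = l23 Q *m l12 Q.
Proof.
have H := mpi_V12Q23; have /(f_equal (fun X => X^t*)) := H.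
rewrite !adjM !leg_adj // adj_initialp => H'.
by rewrite -[l12 Q]legM // mulmxA H' -!mulmxA H.
Qed.

Lemma mpi_Q12P13 : l12 Q *m l13 P = l13 P *m l12 Q.
Proof.
have H : l12 Q *m l13 P = l13 V *m l23 P *m l13 (V^t*).
  by rewrite mpi_V13P23 -mulmxA legM.
have /(f_equal (fun X => X^t*)) := H.
rewrite !adjM !leg_adj // adj_finalp adj_initialp trmxCK => ->.
by rewrite H mulmxA.
Qed.

Lemma mpi_Q13P23 : l13 Q *m l23 P = l23 P *m l13 Q.
Proof.
have H : l13 Q *m l23 P = l13 (V^t*) *m l12 Q *m l13 V.
  by rewrite -mulmxA -mpi_V13P23 mulmxA legM.
have /(f_equal (fun X => X^t*)) := H.
rewrite !adjM !leg_adj // adj_finalp !adj_initialp trmxCK => ->.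
by rewrite H mulmxA.
Qed.

(** The coproduct of the second leg of V: (id (x) Delta)(V) = V12 V13. *)
Lemma mpi_V12V13 : l12 V *m l13 V = l23 V *m l12 V *m l23 (V^t*).
Proof.
rewrite mpi_pentagon -!mulmxA legM // mpi_V13P23 mulmxA legM //.
by rewrite mul_initialp.
Qed.

(** The coproduct of the first leg of V: (Deltah (x) id)(V) = V13 V23. *)
Lemma mpi_V13V23 : l13 V *m l23 V = l12 (V^t*) *m l23 V *m l12 V.
Proof.
rewrite -mulmxA mpi_pentagon !mulmxA legM // -mpi_V13P23 -mulmxA legM //.
by rewrite mul_finalp.
Qed.

(** Multiplying V12 V13 by its adjoint, in the form given by the coproduct,
yields V12 P13 V12^* = P12 P23; then V12 is recovered on the right because
P13 commutes with Q12. *)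
Lemma mpi_V12P13 : l12 V *m l13 P = l23 P *m l12 V.
Proof.
have H : l12 V *m l13 P *m l12 (V^t*) = l12 P *m l23 P.
  have E := mpi_V12V13; have /(f_equal (fun X => X^t*)) := E.
  rewrite !adjM !leg_adj // trmxCK => E'.
  rewrite -[l13 P]legM // -!mulmxA E' mulmxA E -!mulmxA.
  rewrite (mulmxA (l23 (V^t*))) legM // (mulmxA (l12 V)) mpi_V12Q23 -!mulmxA.
  rewrite (mulmxA (l12 V)) legM // mulmxA legM // mul_initialp //.
  by rewrite mulmxA -mpi_P12V23 -mulmxA legM.
rewrite -{1}(mul_initialp Vpi) -legM // -mulmxA mpi_Q12P13 -[l12 Q]legM //.
rewrite !mulmxA H mpi_P12P23 -mulmxA legM //.
by rewrite mul_finalp.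
Qed.

(** The mirror image of the previous identity: (V13 V23)^* (V13 V23) is
V23^* Q13 V23 and, by the coproduct, Q12 Q23. *)
Lemma mpi_V23Q12 : l23 V *m l12 Q = l13 Q *m l23 V.
Proof.
have H : l23 (V^t*) *m l13 Q *m l23 V = l12 Q *m l23 Q.
  have E := mpi_V13V23; have /(f_equal (fun X => X^t*)) := E.
  rewrite !adjM !leg_adj // trmxCK => E'.
  rewrite -[l13 Q]legM // -!mulmxA E !mulmxA E' -!mulmxA.
  rewrite (mulmxA (l12 V)) legM // (mulmxA (l12 P)) mpi_P12V23 -!mulmxA.
  by rewrite legM // mul_finalp // (mulmxA (l23 (V^t*))) legM // -mpi_V12Q23 mulmxA legM.
rewrite -{1}(mul_initialp Vpi) -legM // -mulmxA -mpi_Q12Q23 -H !mulmxA legM //.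
by rewrite -mpi_Q13P23 -mulmxA legM // mul_finalp.
Qed.

Lemma mpi_VQV : l12 (V^t*) *m l23 Q *m l12 V = l23 Q *m l12 Q.
Proof. by rewrite -mulmxA -mpi_V12Q23 mulmxA legM // mpi_Q12Q23. Qed.

(** * Leg identities on slices *)

(** The slices of V span A ([la]) and its dual ([rh]). Those of P span A^L ([xl])
and A^R ([pr]); those of Q span the base algebra of the dual ([qr]) and A^R
again ([rl]). *)
Local Notation la w := (slicel w V).
Local Notation rh w := (slicer w V).
Local Notation xl w := (slicel w P).
Local Notation pr w := (slicer w P).
Local Notation qr w := (slicer w Q).
Local Notation rl w := (slicel w Q).

Lemma la_xl w1 w2 w3 : w3 (la w1 *m xl w2) = w1 (qr w2 *m rh w3).
Proof. by rewrite -slice3_13_23 mpi_V13P23 slice3_12_13. Qed.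

Lemma xl_rh w1 w3 : xl w1 *m rh w3 = rh w3 *m xl w1.
Proof.
by apply: functional_sep => w2; rewrite -slice3_12_23 mpi_P12V23 slice3_23_12.
Qed.

Lemma la_qr w1 w3 : la w1 *m qr w3 = qr w3 *m la w1.
Proof.
by apply: functional_sep => w2; rewrite -slice3_12_23 mpi_V12Q23 slice3_23_12.
Qed.

Lemma rh_pr w1 w2 w3 : w1 (rh w2 *m pr w3) = w2 (pr w3 *m la w1).
Proof. by rewrite -slice3_12_13 mpi_V12P13 slice3_23_12. Qed.

Lemma rh_rl w1 w2 w3 : w2 (rh w3 *m rl w1) = w3 (rl w1 *m la w2).
Proof. by rewrite -slice3_23_12 mpi_V23Q12 slice3_13_23. Qed.

Lemma rh_rh w1 w2 w3 : w1 (rh w2 *m rh w3) = w2 (slicer w3 (Delta V (la w1))).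
Proof. by rewrite -slice3_12_13 mpi_V12V13 slice3_23_12_23. Qed.

Lemma la_la w1 w2 w3 : w3 (la w1 *m la w2) = w2 (slicel w1 (Deltah V (rh w3))).
Proof. by rewrite -slice3_13_23 mpi_V13V23 slice3_12_23_12. Qed.

Lemma Deltah_qr w1 w2 w3 :
  w2 (slicel w1 (Deltah V (qr w3))) = w2 (qr w3 *m rl w1).
Proof. by rewrite -slice3_12_23_12 mpi_VQV slice3_23_12. Qed.

(** For x in A^L this moves x from the second leg on the right of V to an
operator in the first leg on the left, which turns out to be [alpha12]. *)
Lemma V_xlr w : V *m (1%:M *t xl w) = (qr w *t 1%:M) *m V.
Proof.
apply: slicel_sep => w1; apply: functional_sep => w2.
by rewrite slicel_mulr la_xl -slice_swap slicer_mull.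
Qed.

Lemma V_xll w : V *m (xl w *t 1%:M) = (xl w *t 1%:M) *m V.
Proof. by apply: slicer_sep => w1; rewrite slicer_mulr slicer_mull xl_rh. Qed.

Lemma V_qrr w : V *m (1%:M *t qr w) = (1%:M *t qr w) *m V.
Proof. by apply: slicel_sep => w1; rewrite slicel_mulr slicel_mull la_qr. Qed.

Lemma V_prl w : V *m (pr w *t 1%:M) = (1%:M *t pr w) *m V.
Proof.
apply: slicer_sep => w1; apply: functional_sep => w2.
by rewrite slicer_mulr rh_pr slice_swap slicel_mull.
Qed.

Lemma V_rll w : V *m (rl w *t 1%:M) = (1%:M *t rl w) *m V.
Proof.
apply: slicer_sep => w1; apply: functional_sep => w2.
by rewrite slicer_mulr rh_rl slice_swap slicel_mull.
Qed.

End MPI.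

(** * Functional calculus in *-algebras of matrices *)

Section FunctionalCalculus.
Context {C : numClosedFieldType} {m : nat}.
Implicit Types (B : {vspace 'M[C]_m}) (z : 'M[C]_m).

Definition psdmx z : Prop :=
  z^t* = z /\ forall v : 'cV[C]_m, 0 <= (v^t* *m z *m v) 0 0.

Lemma gram_ge0 p (v : 'cV[C]_p) : 0 <= (v^t* *m v) 0 0.
Proof.
by rewrite mxE sumr_ge0 // => i _; rewrite !mxE mulrC -normCK exprn_ge0.
Qed.

Lemma pos_in_psd B z : pos_in B z -> psdmx z.
Proof.
move=> [y _ ->]; split; first by rewrite adjM trmxCK.
by move=> v; rewrite !mulmxA -adjM -mulmxA gram_ge0.
Qed.

Lemma interpolation (s : seq C) (f : C -> C) :
  exists p : {poly C}, {in s, forall x, p.[x] = f x}.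
Proof.
elim: s => [|x s [p ps]]; first by exists 0.
have [xs|xs] := boolP (x \in s).
  by exists p => y; rewrite inE => /predU1P[->|]; apply: ps.
pose q := \prod_(y <- s) ('X - y%:P).
have qx : q.[x] != 0 by rewrite -[_ == _]/(root q x) root_prod_XsubC.
exists (p + ((f x - p.[x]) / q.[x]) *: q) => y.
rewrite inE !hornerE => /predU1P[->|ys]; first by rewrite divfK // subrKC.
by rewrite (rootP (_ : root q y)) ?root_prod_XsubC // mulr0 addr0 ps.
Qed.

Section Calculus.
Context B z (Bs : cstar_alg B) (zB : z \in B) (zh : z^t* = z).

Let U := spectralmx z.
Let d := spectral_diag z.
(* the matrix f(z) *)
Let fc (f : C -> C) : 'M[C]_m := U^t* *m diag_mx (map_mx f d) *m U.

Let UU : U *m U^t* = 1%:M.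
Proof. exact/unitarymxP/spectral_unitarymx. Qed.

Let fcM f g : fc f *m fc g = fc (fun x => f x * g x).
Proof.
rewrite /fc -!mulmxA (mulmxA U) UU mul1mx (mulmxA (diag_mx _)) mulmx_diag.
by congr (_ *m (diag_mx _ *m _)); apply/rowP=> i; rewrite !mxE.
Qed.

Let fcD f g : fc f + fc g = fc (fun x => f x + g x).
Proof.
rewrite /fc -mulmxDl -mulmxDr -raddfD.
by congr (_ *m diag_mx _ *m _); apply/rowP=> i; rewrite !mxE.
Qed.

Let fcZ c f : c *: fc f = fc (fun x => c * f x).
Proof.
rewrite /fc scalemxAl scalemxAr -linearZ.
by congr (_ *m diag_mx _ *m _); apply/rowP=> i; rewrite !mxE.
Qed.

Let fc_id : fc id = z.
Proof.
have /orthomx_spectralP E : z \is normalmx by apply/normalmxP; rewrite zh.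
rewrite [RHS]E /fc -invmx_unitary ?spectral_unitarymx //.
by congr (_ *m diag_mx _ *m _); apply/rowP=> i; rewrite !mxE.
Qed.

Let fc_eq f g : (forall i, f (d 0 i) = g (d 0 i)) -> fc f = fc g.
Proof.
by move=> fg; congr (_ *m diag_mx _ *m _); apply/rowP=> i; rewrite !mxE.
Qed.

(** A polynomial without constant term maps [z] into every algebra that contains it. *)
Let fc_poly (p : {poly C}) : fc (fun x => x * p.[x]) \in B.
Proof.
elim/poly_ind: p => [|p c IH].
  suff -> : fc (fun x => x * (0 : {poly C}).[x]) = 0 *: z by rewrite memvZ.
  by rewrite -[in RHS]fc_id fcZ; apply: fc_eq => i; rewrite horner0 mulr0 mul0r.
rewrite (_ : fc _ = fc (fun x => x * p.[x]) *m z + c *: z).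
  by rewrite memvD ?memvZ //; case: Bs => BM _; apply: BM.
by rewrite -{1 2}fc_id fcM fcZ fcD; apply: fc_eq => i; rewrite !hornerE /=; ring.
Qed.

Let fc_mem f : f 0 = 0 -> fc f \in B.
Proof.
move=> f0; have [p ps] := interpolation [seq d 0 i | i <- enum 'I_m] (fun x => f x / x).
rewrite (_ : fc f = fc (fun x => x * p.[x])) ?fc_poly //; apply: fc_eq => i.
rewrite ps ?map_f ?mem_enum //; have [->|nz] := eqVneq (d 0 i) 0.
  by rewrite f0 mul0r.
by rewrite mulrC divfK.
Qed.

(** w is the inverse of z on the nonzero part of the spectrum and 0 elsewhere. *)
Lemma hermitian_regular : exists2 w, w \in B & z *m w *m z = z.
Proof.
exists (fc (fun x => (x^-1)%R)); first by rewrite fc_mem ?invr0.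
rewrite -{1 2 3}fc_id !fcM; apply: fc_eq => i /=.
by have [->|nz] := eqVneq (d 0 i) 0; rewrite ?mul0r // mulfV ?mul1r.
Qed.

(** Positivity of h inside B requires a square root of h in B; the fourth root
of z serves. *)
Lemma psd_sqrt : psdmx z -> exists2 h, pos_in B h & h *m h = z.
Proof.
move=> [_ z0].
have d0 i : 0 <= d 0 i.
  have := z0 (U^t* *m delta_mx i 0); rewrite -fc_id /fc adjM trmxCK !mulmxA.
  rewrite -(mulmxA _ U) UU mulmx1 -(mulmxA _ U) UU mulmx1.
  by rewrite trmx_delta map_delta_mx -rowE -colE !mxE eqxx mulr1n.
exists (fc (fun x => sqrtC x)).
  exists (fc (fun x => sqrtC (sqrtC x))); first by rewrite fc_mem // !sqrtC0.
  have -> : (fc (fun x => sqrtC (sqrtC x)))^t* = fc (fun x => sqrtC (sqrtC x)).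
    rewrite /fc !adjM trmxCK mulmxA tr_diag_mx map_diag_mx.
    congr (_ *m diag_mx _ *m _); apply/rowP=> i; rewrite !mxE.
    by rewrite /= geC0_conj // !sqrtC_ge0.
  by rewrite fcM; apply: fc_eq => i; rewrite -expr2 sqrtCK.
rewrite fcM -[RHS]fc_id; apply: fc_eq => i.
by rewrite -expr2 sqrtCK.
Qed.

End Calculus.

End FunctionalCalculus.

(** * Faithful positive functionals and their modular automorphism *)

Section FaithfulFunctional.
Context {C : numClosedFieldType} {m : nat}.
Context (B : {vspace 'M[C]_m}) (psi : functional C m) (e : 'M[C]_m).
Context (Bs : cstar_alg B) (Be : is_unit_of B e).
Implicit Types x y z : 'M[C]_m.

Let BM x y : x \in B -> y \in B -> x *m y \in B.
Proof. by case: Bs => BM _; apply: BM. Qed.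

Let Badj x : x \in B -> x^t* \in B.
Proof. by case: Bs => _; apply. Qed.

Let mul1B x : x \in B -> e *m x = x.
Proof. by case: Be => _ /(_ x) H /H []. Qed.

Let mulB1 x : x \in B -> x *m e = x.
Proof. by case: Be => _ /(_ x) H /H []. Qed.

Lemma unit_ofE : unit_of B = e.
Proof.
apply: xget_unique => // y [yB yU].
by have [<- _] := yU e (proj1 Be); rewrite mulB1.
Qed.

Lemma inv_in_unique x y z : is_inv_in B x y -> is_inv_in B x z -> y = z.
Proof.
rewrite /is_inv_in unit_ofE => -[yB xy yx] [zB xz zx].
by rewrite -(mulB1 yB) -xz mulmxA yx mul1B.
Qed.

Lemma inv_inE x y : is_inv_in B x y -> inv_in B x = y.
Proof. by move=> xy; apply: xget_unique => // z /inv_in_unique; apply. Qed.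

Lemma inv_in_unit : inv_in B e = e.
Proof. by apply: inv_inE; case: (Be) => eB _; split; rewrite ?unit_ofE ?mul1B. Qed.

Lemma unit_hermitian : e^t* = e.
Proof.
have eB := proj1 Be; rewrite -[LHS](mulB1 (Badj eB)).
by rewrite -{2}(trmxCK e) -adjM mulB1 ?trmxCK ?Badj.
Qed.

Lemma pos_in_mem x : pos_in B x -> x \in B.
Proof. by move=> [y yB ->]; rewrite BM ?Badj. Qed.

Lemma pos_in_adj x : pos_in B x -> x^t* = x.
Proof. by move=> [y yB ->]; rewrite adjM trmxCK. Qed.

Lemma inv_in_adj x y : is_inv_in B x y -> is_inv_in B (x^t*) (y^t*).
Proof.
rewrite /is_inv_in unit_ofE => -[yB xy yx].
by split; rewrite ?Badj // -adjM ?xy ?yx unit_hermitian.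
Qed.

Lemma inv_in_sqrt h g k :
  h \in B -> h *m h = g -> is_inv_in B g k -> is_inv_in B h (h *m k).
Proof.
rewrite /is_inv_in unit_ofE => hB hh [kB gk kg].
have khhk : k *m h = h *m k.
  rewrite -(mulB1 (BM kB hB)) -gk -hh.
  by rewrite !mulmxA -(mulmxA k) hh kg mul1B.
by split; rewrite ?BM // ?mulmxA ?hh // -khhk -mulmxA hh.
Qed.

Context (psif : faithful_positive B psi).
Context (psi_modular_ex : exists g, is_modular B psi g).

Local Notation g := (g_ B psi).
Local Notation h := (sqrt_in B g).
Local Notation hi := (inv_in B h).

Let gP : is_modular B psi g.
Proof. exact: (@xgetPex _ (0 : 'M[C]_m) [set g | is_modular B psi g]). Qed.

Let hP : pos_in B h /\ h *m h = g.
Proof.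
have [gpos _ _] := gP.
apply: (@xgetPex _ (0 : 'M[C]_m) [set y | pos_in B y /\ y *m y = g]).
have gB := pos_in_mem gpos; have gh := pos_in_adj gpos.
by have [k kpos kk] := psd_sqrt Bs gB gh (pos_in_psd gpos); exists k.
Qed.

Let hB : h \in B. Proof. exact: pos_in_mem (proj1 hP). Qed.

Let hiP : is_inv_in B h hi.
Proof.
have [_ [k kP] _] := gP; have [_ hh] := hP.
by rewrite (inv_inE (inv_in_sqrt hB hh kP)); exact: (inv_in_sqrt hB hh kP).
Qed.

Let hiB : hi \in B. Proof. by case: hiP. Qed.

Let hi_adj : hi^t* = hi.
Proof.
have := inv_in_adj hiP; rewrite (pos_in_adj (proj1 hP)) => H.
exact: inv_in_unique H hiP.
Qed.

Let mulhK x : x \in B -> x *m h *m hi = x.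
Proof.
by move=> xB; case: hiP => _ + _; rewrite unit_ofE -mulmxA => ->; rewrite mulB1.
Qed.

Let mulhiK x : x \in B -> x *m hi *m h = x.
Proof.
by move=> xB; case: hiP => _ _; rewrite unit_ofE -mulmxA => ->; rewrite mulB1.
Qed.

Let ginv : inv_in B g = hi *m hi.
Proof.
apply: inv_inE; split; first exact: BM.
  by rewrite -[X in X *m _](proj2 hP) mulmxA mulhK //; case: hiP.
by rewrite -[X in _ *m _ *m X](proj2 hP) mulmxA mulhiK //; case: hiP.
Qed.

Local Notation thp := (theta_half B psi).
Local Notation thm := (theta_mhalf B psi).

Lemma theta_half_mem x : x \in B -> thp x \in B.
Proof. by move=> xB; rewrite /theta_half !BM. Qed.

Lemma theta_mhalf_mem x : x \in B -> thm x \in B.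
Proof. by move=> xB; rewrite /theta_mhalf !BM. Qed.

Lemma theta_halfK x : x \in B -> thm (thp x) = x.
Proof.
move=> xB; rewrite /theta_half /theta_mhalf !mulmxA mulhiK ?BM //.
by have [_ _ ->] := hiP; rewrite unit_ofE mul1B.
Qed.

Lemma theta_mhalfK x : x \in B -> thp (thm x) = x.
Proof.
move=> xB; rewrite /theta_half /theta_mhalf !mulmxA mulhK ?BM //.
by have [_ -> _] := hiP; rewrite unit_ofE mul1B.
Qed.

Lemma theta_mhalf_adj x : (thm x)^t* = thp (x^t*).
Proof.
by rewrite /theta_half /theta_mhalf !adjM hi_adj (pos_in_adj (proj1 hP)) mulmxA.
Qed.

Lemma theta_mhalf_mul x y : x \in B -> y \in B -> thm (x *m y) = thm x *m thm y.
Proof. by move=> xB yB; rewrite /theta_mhalf !mulmxA mulhK ?BM. Qed.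

Lemma theta_mhalf_lin c x y : thm (c *: x + y) = c *: thm x + thm y.
Proof.
by rewrite /theta_mhalf mulmxDr mulmxDl -scalemxAr -scalemxAl.
Qed.

Lemma psi_modular x y : x \in B -> y \in B ->
  psi (x *m y) = psi (y *m thp (thp x)).
Proof.
move=> xB yB; have [_ _ ->] := gP => //; rewrite ginv -[X in X *m x](proj2 hP).
by rewrite /theta_half !mulmxA.
Qed.

(** The invariance of [psi] under the half-power of its modular automorphism. *)
Lemma psi_theta_half x y : x \in B -> y \in B ->
  psi (thm x *m thp y) = psi (y *m x).
Proof.
move=> xB yB; rewrite psi_modular ?theta_mhalf_mem ?theta_half_mem //.
rewrite theta_mhalfK //.
have -> : thp y *m thp x = h *m (y *m x *m hi).
  by rewrite /theta_half !mulmxA mulhiK ?BM.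
rewrite psi_modular ?BM //; congr (psi _).
by rewrite /theta_half mulhK // !mulmxA mulhiK ?mulhK ?BM.
Qed.

Lemma psi_nondeg z : z \in B -> (forall y, y \in B -> psi (y *m z) = 0) -> z = 0.
Proof. by move=> zB H; case: psif => _; apply=> //; apply/H/Badj. Qed.

Lemma psi_nondegl z : z \in B -> (forall y, y \in B -> psi (z *m y) = 0) -> z = 0.
Proof.
move=> zB H; rewrite -[z]trmxCK; have [_ /(_ (z^t*)) ->] := psif.
- by rewrite trmx0 map_mx0.
- exact: Badj.
- by rewrite trmxCK; apply/H/Badj.
Qed.

Local Notation a i := (tnth (vbasis B) i).
Local Notation b i := (tnth (dual_basis B psi) i).

Lemma vbasis_in i : a i \in B.
Proof. exact/vbasis_mem/mem_tnth. Qed.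

Lemma vbasis_coord x : x \in B -> x = \sum_i coord (vbasis B) i x *: a i.
Proof.
by move=> xB; rewrite {1}(coord_vbasis xB); apply: eq_bigr => i _; rewrite -tnth_nth.
Qed.

(** The Gram matrix of [psi] in the basis of B is invertible by faithfulness, and
its inverse has the dual basis as rows. *)
Lemma dual_basisP : is_dual_basis psi (dual_basis B psi).
Proof.
apply: (@xgetPex _ (vbasis B) [set b | is_dual_basis psi b]).
pose G := \matrix_(i, j) psi (a i *m a j) : 'M[C]_(\dim B).
have Gu : G \in unitmx.
  rewrite -row_free_unit -kermx_eq0; apply/eqP/row_matrixP => k.
  have : row k (kermx G) *m G = 0 by rewrite -row_mul mulmx_ker row0.
  rewrite row0; move: (row k _) => u uG.
  have y0 : \sum_i u 0 i *: a i = 0.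
    apply: psi_nondegl => [|y yB].
      by apply: memv_suml => i _; rewrite memvZ ?vbasis_in.
    rewrite (vbasis_coord yB) mulmx_sumr functional_sum big1 // => j _.
    rewrite -scalemxAr functionalZ mulmx_suml functional_sum.
    have /rowP /(_ j) := uG; rewrite !mxE => E.
    rewrite (_ : \sum_i _ = 0) ?mulr0 // -[RHS]E.
    by apply: eq_bigr => i _; rewrite -scalemxAl functionalZ mxE.
  apply/rowP=> i; rewrite mxE.
  have /freeP := basis_free (vbasisP B); apply.
  by rewrite -[RHS]y0; apply: eq_bigr => j _; rewrite -tnth_nth.
exists [tuple \sum_k invmx G i k *: a k | i < \dim B] => i j; rewrite tnth_mktuple.
split; first by apply: memv_suml => k _; rewrite memvZ ?vbasis_in.
rewrite mulmx_suml functional_sum /=.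
have /matrixP /(_ i j) := mulVmx Gu; rewrite !mxE => <-.
by apply: eq_bigr => k _; rewrite -scalemxAl linearZ mxE.
Qed.

Lemma dual_basis_in i : b i \in B.
Proof. by case: (dual_basisP i i). Qed.

Lemma dual_basis_delta i j : psi (b i *m a j) = (i == j)%:R.
Proof. by case: (dual_basisP i j). Qed.

Lemma dual_basis_expand x : x \in B -> x = \sum_i (psi (b i *m x) : C) *: a i.
Proof.
move=> xB; rewrite {1}(vbasis_coord xB); apply: eq_bigr => i _; congr (_ *: _).
rewrite {2}(vbasis_coord xB) mulmx_sumr functional_sum (bigD1 i) //= big1.
  by rewrite addr0 -scalemxAr functionalZ dual_basis_delta eqxx mulr1.
move=> j ji; rewrite -scalemxAr functionalZ dual_basis_delta eq_sym (negPf ji).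
exact: mulr0.
Qed.

(** By [psi_theta_half], the elements theta^{1/2}(b_i) form a basis whose dual
basis consists of the theta^{-1/2}(a_i). *)
Lemma dual_basis_expand_theta x : x \in B ->
  x = \sum_i (psi (thm (a i) *m x) : C) *: thp (b i).
Proof.
move=> xB; apply/eqP; rewrite -subr_eq0; apply/eqP.
set s := \sum_i _; have sB : s \in B.
  by apply: memv_suml => i _; rewrite memvZ ?theta_half_mem ?dual_basis_in.
have zB : x - s \in B by rewrite memvB.
have za j : psi (thm (a j) *m (x - s)) = 0.
  rewrite mulmxBr linearB /= mulmx_sumr functional_sum (bigD1 j) //= big1.
    rewrite addr0 -scalemxAr functionalZ psi_theta_half ?vbasis_in ?dual_basis_in //.
    by rewrite dual_basis_delta eqxx mulr1 subrr.
  move=> i ij; rewrite -scalemxAr functionalZ psi_theta_half ?vbasis_in ?dual_basis_in //.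
  by rewrite dual_basis_delta (negPf ij); apply: mulr0.
apply: psi_nondeg => // y yB; rewrite -(theta_halfK yB).
rewrite (vbasis_coord (theta_half_mem yB)) /theta_mhalf mulmx_sumr !mulmx_suml.
rewrite functional_sum big1 // => j _.
rewrite -scalemxAr -!scalemxAl functionalZ.
by rewrite -[_ *m a j *m _]/(thm (a j)) za mulr0.
Qed.

End FaithfulFunctional.

(** * The common unit of the two algebras *)

Section Unital.
Context {C : numClosedFieldType} {n : nat} (V : 'M[C]_(n * n)).
Context (eps epsh : functional C n).
Context (mpi : mult_partial_isometry V) (uni : unital V eps epsh).
Implicit Types (w : functional C n).

Local Notation P := (finalp V).
Local Notation Q := (initialp V).
Local Notation la w := (slicel w V).
Local Notation rh w := (slicer w V).
Local Notation xl w := (slicel w P).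
Local Notation pr w := (slicer w P).
Local Notation qr w := (slicer w Q).
Local Notation rl w := (slicel w Q).
Local Notation e := (slicel epsh V).
Let Vpi := mpi_partial mpi.

Lemma memA x : reflect (exists w, x = la w) (x \in A_ V).
Proof.
apply: (iffP memv_imgP) => [[w _ ->]|[w ->]]; exists w; rewrite ?memvf //.
all: by rewrite lamE.
Qed.

Lemma memAhat x : reflect (exists w, x = rh w) (x \in Ahat V).
Proof.
apply: (iffP memv_imgP) => [[w _ ->]|[w ->]]; exists w; rewrite ?memvf //.
all: by rewrite rhoE.
Qed.

Lemma memAL x : reflect (exists w, x = xl w) (x \in AL V).
Proof.
apply: (iffP memv_imgP) => [[w _ ->]|[w ->]]; exists w; rewrite ?memvf //.
all: by rewrite lamE.
Qed.

Lemma unit_mulV : (1%:M *t e) *m V = V.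
Proof.
apply: slicel_sep => w; rewrite slicel_mull -(lamE V epsh).
have [_ eA] := proj1 uni.
by have [|-> _] := eA (la w); first by apply/memA; exists w.
Qed.

Lemma V_mul_unit : V *m (1%:M *t e) = V.
Proof.
apply: slicel_sep => w; rewrite slicel_mulr -(lamE V epsh).
have [_ eA] := proj1 uni.
by have [|_ ->] := eA (la w); first by apply/memA; exists w.
Qed.

Lemma unith_mulV : (rh eps *t 1%:M) *m V = V.
Proof.
apply: slicer_sep => w; rewrite slicer_mull -(rhoE V eps).
have [_ eA] := proj2 uni.
by have [|-> _] := eA (rh w); first by apply/memAhat; exists w.
Qed.

Lemma V_mul_unith : V *m (rh eps *t 1%:M) = V.
Proof.
apply: slicer_sep => w; rewrite slicer_mulr -(rhoE V eps).
have [_ eA] := proj2 uni.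
by have [|_ ->] := eA (rh w); first by apply/memAhat; exists w.
Qed.

(** A^L is contained in A. The formula comes from V13 P23 = Q12 V13 with [epsh]
on the first leg, where V yields the unit. *)
Lemma xl_la w : xl w = la (mulfl (qr w) epsh).
Proof.
apply: functional_sep => w3; rewrite -[RHS]slice_swap mulflE -la_xl //.
by rewrite -slicel_mull /finalp mulmxA unit_mulV.
Qed.

(** The first leg of Q is contained in the first leg algebra of V, by the same
identity with [eps] on the third leg. *)
Lemma qr_rh w : qr w = rh (mulfr (xl w) eps).
Proof.
apply: functional_sep => w1; rewrite [RHS]slice_swap mulfrE la_xl //.
by rewrite -slicer_mulr /initialp -mulmxA V_mul_unith.
Qed.

Let P_mul_unit : P *m (1%:M *t e) = P.
Proof.
by apply: slicel_sep => w; rewrite slicel_mulr xl_la -slicel_mulr V_mul_unit.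
Qed.

Let unith_mulQ : (rh eps *t 1%:M) *m Q = Q.
Proof.
by apply: slicer_sep => w; rewrite slicer_mull qr_rh -slicer_mull unith_mulV.
Qed.

(** Since A^L is contained in A, e is a right unit for the second leg of P. The
adjoint of this says that e^* is a left unit for V, whence e^* e = e. *)
Lemma adj_unit : e^t* = e.
Proof.
suff ee : e^t* *m e = e by rewrite -{1}ee adjM trmxCK ee.
have := f_equal (fun X => X^t*) P_mul_unit.
rewrite adjM adj_finalp adj_tens adjmx1 => /(f_equal (mulmx^~ V)).
by rewrite -mulmxA mul_finalp // => /(f_equal (slicel epsh)); rewrite slicel_mull.
Qed.

Let adj_unith : (rh eps)^t* = rh eps.
Proof.
suff ee : rh eps *m (rh eps)^t* = rh eps.
  by rewrite -{1}ee adjM trmxCK ee.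
have := f_equal (fun X => X^t*) unith_mulQ.
rewrite adjM adj_initialp adj_tens adjmx1 => /(f_equal (mulmx V)).
by rewrite mulmxA mul_initialp // => /(f_equal (slicer eps)); rewrite slicer_mulr.
Qed.

Let la_P w1 w3 : slicer w3 ((1%:M *t la w1) *m P) = slicel (mulfr (rh w3) w1) Q.
Proof.
apply: functional_sep => w2.
by rewrite slice_swap slicel_mull la_xl // -slice_swap mulfrE.
Qed.

(** Let eh be the unit of the dual algebra. Through V13 P23 = Q12 V13, the trivial
action of eh on the first leg of P carries over to the second leg of Q, and that
of e on the second leg of Q to the first leg of P. As both units are Hermitian,
this gives e eh = e and e eh = eh. *)
Lemma counith_unit : rh eps = e.
Proof.
have HQ : (1%:M *t rh eps) *m Q = Q.
  apply: slicel_sep => w; rewrite slicel_mull.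
  have -> : rl w = slicer eps ((1%:M *t la w) *m P).
    by rewrite la_P -slicel_mulfr /initialp -mulmxA V_mul_unith.
  rewrite -slicer_mull mulmxA tens_comm -mulmxA /finalp.
  by rewrite (mulmxA (rh eps *t _)) unith_mulV.
have HP : P *m (e *t 1%:M) = P.
  apply: slicer_sep => w; rewrite slicer_mulr.
  have -> : pr w = slicel (mulfr (rh w) epsh) Q.
    by rewrite -la_P /finalp mulmxA unit_mulV.
  by rewrite -slicel_mulr /initialp -mulmxA V_mul_unit.
have E1 : e *m rh eps = e.
  have := f_equal (fun X => V *m X^t*) HQ.
  rewrite adjM adj_initialp adj_tens adjmx1 adj_unith mulmxA mul_initialp //.
  by move=> /(f_equal (slicel epsh)); rewrite slicel_mulr.
have := f_equal (fun X => X^t* *m V) HP.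
rewrite adjM adj_finalp adj_tens adjmx1 adj_unit -mulmxA mul_finalp //.
by move=> /(f_equal (slicer eps)); rewrite slicer_mull E1.
Qed.

Lemma unitl_mulV : (e *t 1%:M) *m V = V.
Proof. by rewrite -counith_unit unith_mulV. Qed.

Lemma V_mul_unitl : V *m (e *t 1%:M) = V.
Proof. by rewrite -counith_unit V_mul_unith. Qed.

Lemma Delta_unit : Delta V (lam V epsh) = P.
Proof. by rewrite /Delta lamE V_mul_unitl. Qed.

Lemma slicer_Delta w1 w3 : slicer w3 (Delta V (la w1)) = la (mulfr (rh w3) w1).
Proof.
apply: functional_sep => w2.
by rewrite -rh_rh // -[RHS]slice_swap mulfrE.
Qed.

Lemma slicel_Delta w1 w2 : slicel w2 (Delta V (la w1)) = la (mulfl (rh w2) w1).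
Proof.
apply: functional_sep => w3.
by rewrite -slice_swap -rh_rh // -[RHS]slice_swap mulflE.
Qed.

Lemma slicer_eps_Delta w : slicer eps (Delta V (la w)) = la w.
Proof. by rewrite slicer_Delta counith_unit -slicel_mulfr V_mul_unitl. Qed.

Lemma slicer_eps_P : slicer eps P = e.
Proof. by rewrite -Delta_unit lamE slicer_eps_Delta. Qed.

Lemma slicel_eps_P : slicel eps P = e.
Proof.
by rewrite -Delta_unit lamE slicel_Delta counith_unit -slicel_mulfl unitl_mulV.
Qed.

Lemma pr_la w : pr w = la (mulfr (rh w) epsh).
Proof. by rewrite -Delta_unit lamE slicer_Delta. Qed.

Lemma unit_mulP : (1%:M *t e) *m P = P.
Proof. by rewrite /finalp mulmxA unit_mulV. Qed.

Lemma unitl_mulP : (e *t 1%:M) *m P = P.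
Proof. by rewrite /finalp mulmxA unitl_mulV. Qed.

Lemma P_mul_unitl : P *m (e *t 1%:M) = P.
Proof.
by rewrite -{2}adj_finalp -{2}unitl_mulP adjM adj_finalp adj_tens adj_unit adjmx1.
Qed.

(** The functional that represents the product of two slices of V as a slice. *)
Definition prodf (w1 w2 : functional C n) : functional C n.
Proof.
apply: (@functional_of _ _ (fun y => w2 (slicel w1 (Deltah V y)))) => c x y.
rewrite -functional_lin; congr (w2 _).
by rewrite /Deltah tensDr tensZr mulmxDr mulmxDl -scalemxAr -scalemxAl slicelD slicelZ.
Defined.

Lemma la_mul w1 w2 : la w1 *m la w2 = la (prodf w1 w2).
Proof.
apply: functional_sep => w3.
by rewrite la_la // -[RHS]slice_swap functional_ofE.
Qed.

(** * The antipode of the base algebra *)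

Local Notation S x := (slicer eps ((1%:M *t x) *m P)).

Lemma S_E x : S_ V eps epsh x = S x.
Proof.
rewrite /S_ Delta_unit slicer_mulfl; apply/matrixP=> i j.
by rewrite !mxE mulflE.
Qed.

(** On all of A, [S] is the slice of Q at the same functional. *)
Lemma S_la w : S (la w) = rl w.
Proof.
by rewrite la_P counith_unit -slicel_mulfr /initialp -mulmxA V_mul_unitl.
Qed.

Lemma S_pr x : S x = pr (mulfl x eps).
Proof. by rewrite slicer_mulfl. Qed.

(** Weak multiplicativity of the counit: eps(a b c) depends on a through S(a)
only, when c ranges over the second leg of P. Both sides are computed as slices
of Q23 Q12. *)
Lemma S_S w1 w2 : S (la w1 *m la w2) = S (S (la w1) *m la w2).
Proof.
rewrite la_mul !S_la -[rl w1 *m _]slicel_mull -V_rll // slicel_mulfr S_la.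
apply: functional_sep => w3; rewrite -!slice_swap mulfrE functional_ofE.
exact: Deltah_qr.
Qed.

(** An element that V moves from the first leg to the second has coproduct
(1 (x) a) P, and applying the counit returns a. *)
Lemma S_fix w : V *m (la w *t 1%:M) = (1%:M *t la w) *m V -> S (la w) = la w.
Proof.
by move=> H; rewrite /finalp mulmxA -H -[_ *m V^t*]/(Delta V (la w)) slicer_eps_Delta.
Qed.

(** The relation on which everything about A^L rests. Slicing the second leg, it
says that S(x p) = S(x) p for p in the first leg of P: by [S_S] the left side
is S(S(x) p), and S(x) p is fixed by [S]. *)
Lemma S_mulP w : let x := xl w in (1%:M *t x) *m P = (S x *t 1%:M) *m P.
Proof.
move=> x; have [u xu] : exists u : functional C n, x = la u by eexists; exact: xl_la.
apply: slicer_sep => w3; rewrite slicer_mull.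
have xP : x *m pr w3 = la (mulfr (rh w3) u).
  rewrite -slicer_mull -slicer_Delta -xu; congr (slicer _ _).
  by rewrite /Delta V_xll // /finalp mulmxA.
rewrite {1}xu la_P -S_la -xP xu pr_la S_S -pr_la S_la.
have rlA : exists v : functional C n, rl u *m pr w3 = la v.
  by rewrite -S_la S_pr !pr_la la_mul; eexists.
have [v rv] := rlA; rewrite rv; apply: S_fix; rewrite -rv.
rewrite -[X in _ *m (_ *t X)](mul1mx 1%:M) -tensmx_mul mulmxA V_rll //.
by rewrite -mulmxA V_prl // mulmxA tensmx_mul mul1mx.
Qed.

Lemma AL_mul : {in AL V &, forall x y, x *m y \in AL V}.
Proof.
move=> x y /memAL [u ->] /memAL [v ->]; apply/memAL.
by rewrite -slicel_mull S_mulP slicel_mulfl; eexists.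
Qed.

Lemma AL_adj : {in AL V, forall x, x^t* \in AL V}.
Proof.
move=> x /memAL [u ->]; apply/memAL; exists (conjf u).
by rewrite -{2}adj_finalp slicel_adj conjfK.
Qed.

Lemma AL_unit : is_unit_of (AL V) e.
Proof.
split; first by apply/memAL; exists eps; rewrite slicel_eps_P.
move=> x /memAL [u ->]; split; first by rewrite -slicel_mull unit_mulP.
by rewrite -slicel_mulr P_mul_unit.
Qed.

End Unital.

(** * Positivity and modularity of the counit on the base algebra *)

Section Traces.
Context {C : numClosedFieldType}.

Lemma trace_gram_ge0 p q (M : 'M[C]_(p, q)) : 0 <= \tr (M *m M^t*).
Proof.
rewrite /mxtrace sumr_ge0 // => i _; rewrite mxE sumr_ge0 // => j _.
by rewrite !mxE -normCK exprn_ge0.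
Qed.

Lemma trace_gram_eq0 p q (M : 'M[C]_(p, q)) : \tr (M *m M^t*) = 0 -> M = 0.
Proof.
rewrite /mxtrace => /eqP; rewrite psumr_eq0; last first.
  by move=> i _; rewrite mxE sumr_ge0 // => j _; rewrite !mxE -normCK exprn_ge0.
move=> /allP H; apply/matrixP=> i j; rewrite mxE.
have := H i (mem_index_enum _); rewrite /= mxE psumr_eq0; last first.
  by move=> k _; rewrite !mxE -normCK exprn_ge0.
move=> /allP /(_ j (mem_index_enum _)); rewrite /= !mxE -normCK.
by rewrite expf_eq0 normr_eq0 => /eqP.
Qed.

Lemma trace_slicel n (X : 'M[C]_(n * n)) : \tr (slicel tracef X) = \tr X.
Proof.
rewrite /mxtrace; under eq_bigr do rewrite mxE tracefE /mxtrace.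
rewrite exchange_big pair_big /=.
rewrite (reindex (@mxtens_index n n)) /=; last first.
  by exists (@mxtens_unindex n n) => i _; rewrite (mxtens_indexK, mxtens_unindexK).
by apply: eq_bigr => -[i j] _; rewrite mxE.
Qed.

End Traces.

Section BaseAlgebra.
Context {C : numClosedFieldType} {n : nat} (V : 'M[C]_(n * n)).
Context (eps epsh : functional C n).
Context (mpi : mult_partial_isometry V) (uni : unital V eps epsh).
Implicit Types (w : functional C n) (x y : 'M[C]_n).

Local Notation P := (finalp V).
Local Notation xl w := (slicel w P).
Local Notation e := (slicel epsh V).
Local Notation S x := (slicer eps ((1%:M *t x) *m P)).
Local Notation B := (AL V).

Let Vpi := mpi_partial mpi.
Let AM x y : x \in B -> y \in B -> x *m y \in B := @AL_mul _ _ _ _ _ mpi uni x y.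
Let Aadj x : x \in B -> x^t* \in B := @AL_adj _ _ V x.

Lemma AL_cstar : cstar_alg B.
Proof. by split=> [x y xB yB|x xB]; [exact: AM|exact: Aadj]. Qed.

Let eU : is_unit_of B e := AL_unit mpi uni.
Let mul1B x : x \in B -> e *m x = x.
Proof. by case: eU => _ /(_ x) H /H []. Qed.
Let mulB1 x : x \in B -> x *m e = x.
Proof. by case: eU => _ /(_ x) H /H []. Qed.

Lemma S_mul x : x \in B -> (1%:M *t x) *m P = (S x *t 1%:M) *m P.
Proof. by move=> /memAL [w ->]; exact: (S_mulP mpi uni). Qed.

Lemma S_mul1 x : S x *m e = S x.
Proof. by rewrite -slicer_mulr -mulmxA (P_mul_unitl mpi uni). Qed.

Lemma S_lin c x y : S (c *: x + y) = c *: S x + S y.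
Proof. by rewrite tensDr tensZr mulmxDl -scalemxAl slicerD slicerZ. Qed.

Lemma S_anti x y : x \in B -> y \in B -> S (x *m y) = S y *m S x.
Proof.
move=> xB yB; have Ex := S_mul xB; have Ey := S_mul yB; have Sy1 := S_mul1 x.
move: (S x) (S y) Ex Ey Sy1 => sx sy Ex Ey Sy1.
have -> : (1%:M *t (x *m y)) *m P = ((sy *m sx) *t 1%:M) *m P.
  transitivity ((1%:M *t x) *m ((1%:M *t y) *m P)).
    by rewrite mulmxA tensmx_mul mulmx1.
  by rewrite Ey mulmxA -tens_comm -mulmxA Ex mulmxA tensmx_mul mulmx1.
by rewrite slicer_mull (slicer_eps_P mpi uni) -mulmxA Sy1.
Qed.

Lemma eps_S w x : w (S x) = eps (x *m xl w).
Proof. by rewrite slice_swap slicel_mull. Qed.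

Lemma S_eq0 x : x \in B -> S x = 0 -> x = 0.
Proof.
move=> xB S0; rewrite -(mulB1 xB) -(slicel_eps_P mpi uni) -slicel_mull S_mul //.
by rewrite S0 tens0mx mul0mx slicel0.
Qed.

(** The positive element z = (Tr (x) id)(P) of A^L compares the counit with the
trace: eps(x z) = Tr(S x), and Tr o S is a trace on A^L because S is
anti-multiplicative. *)
Local Notation z := (xl tracef).

Let zB : z \in B. Proof. by apply/memAL; exists tracef. Qed.

Let zh : z^t* = z.
Proof.
rewrite -{2}adj_finalp slicel_adj; congr (map_mx _ (trmx _)).
apply/matrixP=> k l; rewrite !mxE conjfE !tracefE /mxtrace rmorph_sum.
by apply: eq_bigr => i _; rewrite !mxE /= conjCK.
Qed.

(** As P is a Hermitian idempotent, pairing z with a positive matrix under the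
trace gives a squared norm. *)
Let z_gram p (t : 'M[C]_(n, p)) (M := P *m (1%:M *t t) : 'M[C]_(n * n, n * p)) :
  \tr (z *m (t *m t^t*)) = \tr (M *m M^t*).
Proof.
rewrite -slicel_mulr trace_slicel /M adjM adj_finalp adj_tens adjmx1.
rewrite [in RHS]mulmxA [in RHS]mxtrace_mulC.
by rewrite -[in RHS](mulmxA P) tensmx_mul mulmx1 (mulmxA P) finalp_idem.
Qed.

Let z_psd : psdmx z.
Proof.
split=> // v; suff -> : (v^t* *m z *m v) 0 0 = \tr (z *m (v *m v^t*)).
  by rewrite z_gram trace_gram_ge0.
by rewrite mulmxA mxtrace_mulC mulmxA trace_mx11.
Qed.

(** If z t = 0, then P (1 (x) t) = 0 by the previous identity, and the counit on
the first leg gives e t = 0. *)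
Let z_inj (t : 'M[C]_n) : z *m t = 0 -> e *m t = 0.
Proof.
move=> zt; have := z_gram t; rewrite mulmxA zt mul0mx linear0 => /esym.
move=> /trace_gram_eq0 H.
by rewrite -(slicel_eps_P mpi uni) -slicel_mulr H slicel0.
Qed.

Let z_inv : exists k, is_inv_in B z k.
Proof.
have [w wB zwz] := hermitian_regular AL_cstar zB zh.
have wz : w *m z = e.
  apply/eqP; rewrite eq_sym -subr_eq0; apply/eqP.
  have eB := proj1 eU.
  rewrite -[LHS]mul1B ?memvB ?AM //; apply: z_inj.
  by rewrite mulmxBr mulB1 // mulmxA zwz subrr.
have zw : z *m w^t* = e.
  by rewrite -{1}zh -adjM wz (adj_unit mpi uni).
exists w; split; rewrite ?(unit_ofE eU) //.
by rewrite -[w]mulB1 // -zw (mulmxA w) wz mul1B ?Aadj.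
Qed.

Let eps_z x : eps (x *m z) = \tr (S x).
Proof. by rewrite -eps_S tracefE. Qed.

(** Moving x through P on both sides turns it into S(x) on the first leg. *)
Let eps_xzx x : x \in B -> eps (x *m z *m x^t*) = \tr (S x *m (S x)^t*).
Proof.
move=> xB; have E := S_mul xB; have s1 := S_mul1 x.
move: (S x) E s1 => s E s1.
have E' : P *m (1%:M *t x^t*) = P *m (s^t* *t 1%:M).
  have := f_equal (fun X => X^t*) E.
  by rewrite adjM adj_finalp adjM adj_finalp !adj_tens adjmx1.
rewrite -slicel_mull -slicel_mulr E -mulmxA E' mulmxA.
rewrite slicel_mulfr slicel_mulfl -slice_swap mulflE mulfrE tracefE.
by rewrite (slicer_eps_P mpi uni) s1.
Qed.

Let z_sqrt : exists2 y, y \in B /\ y^t* = y & y *m y = z.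
Proof.
have [y ypos yy] := psd_sqrt AL_cstar zB zh z_psd; exists y => //.
by split; [exact: (pos_in_mem AL_cstar ypos)|exact: (pos_in_adj ypos)].
Qed.

(** With y an invertible Hermitian square root of z, every t is the adjoint of some x y, so that
eps(t^* t) = eps(x z x^* ) is the squared norm of S(x); and [S] is injective. *)
Lemma eps_faithful_positive : faithful_positive B eps.
Proof.
have [y [yB yh] yy] := z_sqrt; have [w zw] := z_inv.
have [yiB] := inv_in_sqrt AL_cstar eU yB yy zw; move: (y *m w) yiB => yi yiB.
rewrite (unit_ofE eU) => yyi yiy.
have main t : t \in B -> let x := t^t* *m yi in
    [/\ x \in B, x *m y = t^t* & eps (t^t* *m t) = \tr (S x *m (S x)^t*)].
  move=> tB x; have xB : x \in B by rewrite AM ?Aadj.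
  have xy : x *m y = t^t* by rewrite -mulmxA yiy mulB1 ?Aadj.
  split=> //; rewrite -eps_xzx // -yy mulmxA xy -mulmxA; congr (eps (_ *m _)).
  by rewrite -{1}yh -adjM xy trmxCK.
split=> t tB; have [xB xy E] := main t tB; first by rewrite E trace_gram_ge0.
rewrite E => /trace_gram_eq0 /(S_eq0 xB) x0; move: xy; rewrite x0 mul0mx.
by move=> /(f_equal (fun X => X^t*)); rewrite trmxCK => <-; rewrite trmx0 map_mx0.
Qed.

(** As eps(x z) = Tr(S x) is a trace, z^{-1} implements the modular automorphism. *)
Lemma eps_modular_ex : exists g, is_modular B eps g.
Proof.
have [y [yB yh] yy] := z_sqrt; have [w zw] := z_inv.
have [wB zwe wze] := zw; rewrite !(unit_ofE eU) in zwe wze.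
have wz : is_inv_in B w z by split; rewrite ?(unit_ofE eU).
have wh : w^t* = w.
  have := inv_in_adj AL_cstar eU zw; rewrite zh => H.
  exact: (inv_in_unique eU H zw).
exists w; split; last 2 first.
- by exists z.
- move=> x t xB tB; rewrite (inv_inE eU wz) !mulmxA eps_z.
  rewrite -{1}(mulB1 tB) -wze !mulmxA eps_z -(mulmxA x) S_anti ?AM //.
  by rewrite mxtrace_mulC -S_anti ?AM // mulmxA.
exists (y *m w); first exact: AM.
by rewrite adjM wh yh -!mulmxA (mulmxA y) yy zwe mulB1.
Qed.

End BaseAlgebra.

(** * The two projections and the three actions *)

Section Actions.
Context {C : numClosedFieldType} {n : nat} (V : 'M[C]_(n * n)).
Context (eps epsh : functional C n).
Context (mpi : mult_partial_isometry V) (uni : unital V eps epsh).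
Implicit Types (w : functional C n) (x y : 'M[C]_n).

Local Notation P := (finalp V).
Local Notation Q := (initialp V).
Local Notation la w := (slicel w V).
Local Notation rh w := (slicer w V).
Local Notation xl w := (slicel w P).
Local Notation pr w := (slicer w P).
Local Notation qr w := (slicer w Q).
Local Notation e := (slicel epsh V).
Local Notation S x := (slicer eps ((1%:M *t x) *m P)).
Local Notation B := (AL V).
Local Notation a i := (tnth (vbasis B) i).
Local Notation b i := (tnth (dual_basis B eps) i).
Local Notation thp := (theta_half B eps).
Local Notation thm := (theta_mhalf B eps).
Local Notation a02 := (alpha02 V eps epsh).
Local Notation a12 := (alpha12 V eps).

Let Bs : cstar_alg B := AL_cstar mpi uni.
Let eU : is_unit_of B e := AL_unit mpi uni.
Let epsf : faithful_positive B eps := eps_faithful_positive mpi uni.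
Let epsm := eps_modular_ex mpi uni.

Let xlB w : xl w \in B. Proof. by apply/memAL; exists w. Qed.
Let aB i : a i \in B. Proof. exact: vbasis_in. Qed.
Let bB i : b i \in B := dual_basis_in Bs epsf i.
Let mul1B x : x \in B -> e *m x = x.
Proof. by case: eU => _ /(_ x) H /H []. Qed.
Let mulB1 x : x \in B -> x *m e = x.
Proof. by case: eU => _ /(_ x) H /H []. Qed.
Let thmB x : x \in B -> thm x \in B := @theta_mhalf_mem _ _ _ _ _ Bs eU epsm x.
Let thpB x : x \in B -> thp x \in B := @theta_half_mem _ _ _ _ _ Bs eU epsm x.

(** By [eps_S], the coefficients of a slice of P along (a_i) are the values of
its functional on the S(b_i). *)
Lemma finalp_dual_basis : P = \sum_i S (b i) *t a i.
Proof.
apply: slicel_sep => w; rewrite slicel_sum.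
rewrite {1}(dual_basis_expand Bs epsf (xlB w)); apply: eq_bigr => i _.
by rewrite slicel_tens eps_S.
Qed.

(** Compare P P = P with the expansion of P in the basis: moving S(b_i) through
P gives P = (1 (x) Ind) P. *)
Lemma index_eps : Ind B eps = e.
Proof.
rewrite -(slicel_eps_P mpi uni) -(finalp_idem (mpi_partial mpi)).
rewrite [X in slicel _ (X *m _)]finalp_dual_basis mulmx_suml slicel_sum.
apply: eq_bigr => i _.
have -> : (S (b i) *t a i) *m P = (1%:M *t (a i *m b i)) *m P.
  transitivity ((1%:M *t a i) *m ((S (b i) *t 1%:M) *m P)).
    by rewrite [RHS]mulmxA tensmx_mul mul1mx mulmx1.
  by rewrite -(S_mul mpi uni (bB i)) [LHS]mulmxA tensmx_mul mulmx1.
rewrite slicel_mull (slicel_eps_P mpi uni) mulB1 //.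
by case: Bs => BM _; apply: BM.
Qed.

Lemma alpha02E x : a02 x = S (thm x).
Proof. by rewrite /alpha02 (S_E mpi uni). Qed.

Let e_appE (f k : 'M[C]_n -> 'M[C]_n) :
  e_app B eps f k = \sum_i f (a i) *t k (thp (b i)).
Proof.
apply: eq_bigr => i _; congr (f _ *t _).
by rewrite index_eps (inv_in_unit eU) mul1B.
Qed.

(** The expansion of the second leg of P in the basis theta^{1/2}(b_i) has the
coefficients S(theta^{-1/2}(a_i)). *)
Lemma finalp_e_app : P = e_app B eps a02 alpha01.
Proof.
rewrite e_appE; apply: slicel_sep => w; rewrite slicel_sum.
rewrite {1}(dual_basis_expand_theta Bs eU epsf epsm (xlB w)); apply: eq_bigr => i _.
by rewrite slicel_tens alpha02E eps_S.
Qed.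

Let slicel_Deltah w1 w3 : slicel w1 (Deltah V (rh w3)) = rh (mulfl (la w1) w3).
Proof.
by apply: functional_sep => w2; rewrite -la_la // [RHS]slice_swap mulflE.
Qed.

(** The pairing is independent of the functionals that represent its arguments,
hence it is evaluation of w. *)
Let pairing_la w y : y \in Ahat V -> pairing V (la w) y = w y.
Proof.
move=> yA; rewrite /pairing -slice_swap.
have -> : slicer ((rho V)^-1%VF y) V = y by rewrite -rhoE limg_lfunVK.
have /memAhat [u ->] := yA; rewrite !slice_swap -lamE limg_lfunVK //.
by apply/memA; exists w.
Qed.

Let alpha12_la w : a12 (la w) = slicer eps (V *m (1%:M *t la w)).
Proof.
have -> : a12 (la w) = slicer w (Deltah V (rh eps)).
  rewrite /alpha12 rhoE; apply/matrixP=> i j; rewrite !mxE pairing_la.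
    by [].
  apply/memAhat; exists (mulfl (la (coordf i j)) eps).
  by rewrite -slicel_Deltah; apply/matrixP=> k l; rewrite [RHS]mxE coordfE !mxE.
apply: functional_sep => w1; rewrite slice_swap -la_la //.
by rewrite [RHS]slice_swap slicel_mulr.
Qed.

Lemma alpha12_xl w : a12 (xl w) = qr w.
Proof.
rewrite (xl_la mpi uni) alpha12_la -(xl_la mpi uni) V_xlr // slicer_mull.
rewrite (counith_unit mpi uni) -slicer_mulr /initialp -mulmxA.
by rewrite (V_mul_unitl mpi uni).
Qed.

Let alpha12_B x : x \in B -> a12 x = slicer eps (V *m (1%:M *t x)).
Proof. by move=> /memAL [w ->]; rewrite (xl_la mpi uni) alpha12_la. Qed.

Lemma V_alpha12 x : x \in B -> V *m (1%:M *t x) = (a12 x *t 1%:M) *m V.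
Proof. by move=> /memAL [w ->]; rewrite alpha12_xl V_xlr. Qed.

Let alpha12_1 x : x \in B -> a12 x *m e = a12 x.
Proof.
move=> /memAL [w ->]; rewrite alpha12_xl -slicer_mulr /initialp -mulmxA.
by rewrite (V_mul_unitl mpi uni).
Qed.

Let alpha12_lin c x y : x \in B -> y \in B -> a12 (c *: x + y) = c *: a12 x + a12 y.
Proof.
move=> xB yB; rewrite !alpha12_B ?memvD ?memvZ //.
by rewrite tensDr tensZr mulmxDr -scalemxAr slicerD slicerZ.
Qed.

(** The slices of Q in the second leg are [alpha12] of the slices of P in the
first one, so the expansion of P along (a_i) yields one of Q. *)
Lemma initialp_e_app : Q = e_app B eps a12 a02.
Proof.
rewrite e_appE; apply: slicer_sep => w; rewrite slicer_sum.
under eq_bigr => i _ do rewrite slicer_tens alpha02E (theta_halfK Bs eU epsm (bB i)).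
rewrite -alpha12_xl {1}(dual_basis_expand Bs epsf (xlB w)).
suff -> (f : 'I_(\dim B) -> C) :
    a12 (\sum_i f i *: a i) = \sum_i f i *: a12 (a i).
  by apply: eq_bigr => i _; rewrite eps_S.
have fB : \sum_i f i *: a i \in B by apply: memv_suml => i _; rewrite memvZ.
apply: functional_sep => u; rewrite alpha12_B // slice_swap slicel_mulr.
rewrite mulmx_sumr !functional_sum; apply: eq_bigr => i _.
by rewrite alpha12_B // -scalemxAr !functionalZ slice_swap slicel_mulr.
Qed.

Lemma alpha12_star_hom : star_hom B a12.
Proof.
split.
- by move=> c x y xB yB; apply: alpha12_lin.
- move=> x y xB yB; have xyB : x *m y \in B by case: Bs => BM _; apply: BM.
  rewrite (alpha12_B xyB) -[X in X *t (x *m y)](mulmx1 1%:M) -tensmx_mul mulmxA.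
  rewrite V_alpha12 // -mulmxA V_alpha12 // slicer_mull slicer_mull.
  by rewrite (counith_unit mpi uni) alpha12_1.
- move=> _ /memAL [w ->]; rewrite alpha12_xl.
  have -> : (xl w)^t* = xl (conjf w) by rewrite -{2}adj_finalp slicel_adj conjfK.
  by rewrite alpha12_xl -{1}adj_initialp slicer_adj conjfK.
Qed.

Lemma alpha02_pr x : exists w, a02 x = pr w.
Proof. by rewrite alpha02E S_pr; eexists. Qed.

(** The adjoint of (1 (x) x^* ) P = (S(x^* ) (x) 1) P moves x through P from the
other side, which amounts to exchanging the factors under the counit: the
modular automorphism appears, and S(x^* )^* = S(theta^{-1}(x)). *)
Lemma S_adj x : x \in B -> (S (x^t*))^t* = S (thm (thm x)).
Proof.
move=> xB; have xB' : x^t* \in B by case: Bs => _; apply.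
have E := S_mul mpi uni xB'; have s1 := S_mul1 mpi uni (x^t*).
move: (S (x^t*)) E s1 => s E s1.
have E' : P *m (1%:M *t x) = P *m (s^t* *t 1%:M).
  have := f_equal (fun X => X^t*) E.
  by rewrite adjM adj_finalp adjM adj_finalp !adj_tens adjmx1 trmxCK.
have es : e *m s^t* = s^t* by rewrite -{1}(adj_unit mpi uni) -adjM s1.
rewrite -es -(slicer_eps_P mpi uni) -slicer_mulr -E'.
apply: functional_sep => w; rewrite !slice_swap slicel_mulr slicel_mull.
by rewrite (psi_modular Bs eU epsm (thmB (thmB xB)) (xlB w)) !(theta_mhalfK Bs eU epsm) // thmB.
Qed.

(** By [S_adj], [S] fails to preserve adjoints by theta^{-1}; precomposing with
theta^{-1/2} distributes this defect symmetrically over both sides. *)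
Lemma alpha02_star_antihom : star_antihom B a02.
Proof.
split.
- by move=> c x y _ _; rewrite !alpha02E theta_mhalf_lin S_lin.
- move=> x y xB yB; rewrite !alpha02E (theta_mhalf_mul Bs eU epsm) //.
  by rewrite (S_anti mpi uni) ?thmB.
- move=> x xB; have xB' : x^t* \in B by case: Bs => _; apply.
  rewrite !alpha02E; have tB := thpB xB'.
  have := S_adj tB; rewrite (theta_halfK Bs eU epsm) // => <-.
  by rewrite -(theta_mhalf_adj Bs eU epsm) trmxCK.
Qed.

Lemma alpha01_star_hom : star_hom B alpha01.
Proof. by split. Qed.

Lemma alpha01_alpha02 : commuting B alpha01 a02.
Proof.
move=> x y /memAL [w ->] yB; have [u ->] := alpha02_pr y.
by apply: functional_sep => w2; rewrite /alpha01 -slice3_12_23 mpi_P12P23 // slice3_23_12.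
Qed.

Lemma alpha01_alpha12 : commuting B alpha01 a12.
Proof.
move=> x y /memAL [w ->] /memAL [u ->]; rewrite alpha12_xl /alpha01.
by rewrite (xl_la mpi uni) la_qr.
Qed.

Lemma alpha02_alpha12 : commuting B a02 a12.
Proof.
move=> x y xB /memAL [u ->]; rewrite alpha12_xl; have [w ->] := alpha02_pr x.
by rewrite (pr_la mpi uni) la_qr.
Qed.

End Actions.

(** * Partial isometries as unitaries between ranges *)

Section Ranges.
Context {C : numClosedFieldType} {m : nat}.

Lemma maps_ran (X M N Y : 'M[C]_m) : X *m M = N *m Y -> maps X (ran M) (ran N).
Proof. by move=> E _ [u _ <-]; exists (Y *m u) => //; rewrite !mulmxA E. Qed.

End Ranges.

Section PartialIsometryRanges.
Context {C : numClosedFieldType} {n : nat} (V : 'M[C]_(n * n)).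
Context (Vpi : V *m V^t* *m V = V).

Lemma partial_isometry_unitary : unitary_between (initialp V) (finalp V) V.
Proof.
split.
- by apply: (@maps_ran _ _ _ _ _ V); rewrite mul_initialp // mul_finalp.
- move=> _ _ /set_mem [u _ <-] /set_mem [v _ <-].
  rewrite (mulmxA V _ u) (mulmxA V _ v) mul_initialp // (adjM V) (adjM (initialp V)) adj_initialp.
  rewrite -[RHS]mulmxA (mulmxA (initialp V)) initialp_idem //.
  by rewrite -[LHS]mulmxA [X in _ *m X = _]mulmxA.
- move=> _ [u _ <-]; exists (V^t* *m u); last by rewrite mulmxA.
  by exists (V^t* *m u) => //; rewrite mulmxA initialp_adj.
Qed.

(** The relation for the adjoints makes X commute with the initial and Y with the
final projection, so that both preserve the relevant subspace. *)
Lemma partial_isometry_intertwines X Y :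
  V *m X = Y *m V -> V *m X^t* = Y^t* *m V ->
  intertwines (initialp V) (finalp V) V X Y.
Proof.
move=> VX VX'; have VX'' : V^t* *m Y = X *m V^t*.
  by have := f_equal (fun X => X^t*) VX'; rewrite !adjM !trmxCK.
split.
- apply: (@maps_ran _ _ _ _ _ X).
  by rewrite /initialp mulmxA -VX'' -mulmxA -VX mulmxA.
- apply: (@maps_ran _ _ _ _ _ Y).
  by rewrite /finalp -[RHS]mulmxA VX'' !mulmxA VX.
- by move=> v _; rewrite !mulmxA VX.
Qed.

End PartialIsometryRanges.

(** * Permutations of the legs *)

Section Pentagon.
Context {C : numClosedFieldType} {n : nat} (V : 'M[C]_(n * n)).
Context (mpi : mult_partial_isometry V).

Local Notation P := (finalp V).
Local Notation Q := (initialp V).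

Lemma flip_leg (i j k l : 'I_3) (X : 'M[C]_(n * n)) :
  flip i j *m leg k l X = leg (tperm i j k) (tperm i j l) X *m flip i j.
Proof. exact: permop_leg (tpermK i j) (tpermK i j) _ _ _. Qed.

Lemma flipK (i j : 'I_3) : flip i j *m flip i j = 1%:M :> 'M[C]_(n * n * n).
Proof. exact: permopK (tpermK i j) (tpermK i j). Qed.

Let cyc (k : 'I_3) := if k == f1 then f3 else if k == f2 then f1 else f2.
(** The inverse of [cyc], the permutation underlying [flip12_3]. *)
Let cyc' (k : 'I_3) := if k == f1 then f2 else if k == f2 then f3 else f1.

Let ord3 (k : 'I_3) : [\/ k = f1, k = f2 | k = f3].
Proof.
by case: k => [[|[|[|//]]] lt3]; [constructor 1|constructor 2|constructor 3];
  apply: val_inj.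
Qed.

Let cycK : cancel cyc cyc'.
Proof. by move=> k; case: (ord3 k) => ->. Qed.
Let cycK' : cancel cyc' cyc.
Proof. by move=> k; case: (ord3 k) => ->. Qed.

Lemma flip12_3_leg (k l : 'I_3) (X : 'M[C]_(n * n)) :
  flip12_3 *m leg k l X = leg (cyc' k) (cyc' l) X *m flip12_3.
Proof. exact: permop_leg cycK cycK' _ _ _. Qed.

Lemma flip12_3_flip23 :
  flip12_3 *m flip f2 f3 = flip f1 f2 :> 'M[C]_(n * n * n).
Proof.
rewrite /flip12_3 (permop_comp _ cycK cycK') /flip /permop; apply/matrixP=> a b.
rewrite !mxE; congr (nat_of_bool _)%:R.
by rewrite !forall3 /= !permE.
Qed.

(** The identity V13 P23 = Q12 V13 with the first two factors exchanged. *)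
Lemma mpi_V23P13 : leg f2 f3 V *m leg f1 f3 P = leg f2 f1 Q *m leg f2 f3 V.
Proof.
have := f_equal (fun X => flip f1 f2 *m X *m flip f1 f2) (mpi_V13P23 mpi).
rewrite !mulmxA !flip_leg -!mulmxA !(mulmxA (flip f1 f2)) !flip_leg -!mulmxA.
by rewrite flipK !mulmx1 !permE.
Qed.

Lemma mpi_P13Q23 : leg f1 f3 P *m leg f2 f3 Q = leg f2 f3 Q *m leg f1 f3 P.
Proof.
have H : leg f2 f3 Q *m leg f1 f3 P
    = leg f2 f3 (V^t*) *m leg f2 f1 Q *m leg f2 f3 V.
  by rewrite -mulmxA -mpi_V23P13 mulmxA legM.
have /(f_equal (fun X => X^t*)) := H.
rewrite !adjM !leg_adj // adj_finalp !adj_initialp trmxCK => ->.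
by rewrite H mulmxA.
Qed.

End Pentagon.

(** * The pseudo-multiplicative unitary *)

Section PseudoMultiplicative.
Context {C : numClosedFieldType} {n : nat} (V : 'M[C]_(n * n)).
Context (mpi : mult_partial_isometry V).

Local Notation P := (finalp V).
Local Notation Q := (initialp V).
Local Notation l12 := (leg f1 f2).
Local Notation l13 := (leg f1 f3).
Local Notation l23 := (leg f2 f3).
Let Vpi := mpi_partial mpi.

Let VQ (i j : 'I_3) : i != j -> leg i j V *m leg i j Q = leg i j V.
Proof. by move=> ij; rewrite legM // mul_initialp. Qed.

Let PV (i j : 'I_3) : i != j -> leg i j P *m leg i j V = leg i j V.
Proof. by move=> ij; rewrite legM // mul_finalp. Qed.

Lemma maps_V12_V23 :
  maps (l12 V) (ran (l12 Q *m l23 Q)) (ran (l12 P *m l23 Q)) /\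
  maps (l23 V) (ran (l12 P *m l23 Q)) (ran (l12 P *m l23 P)).
Proof.
split; [apply: (@maps_ran _ _ _ _ _ (l12 V))|apply: (@maps_ran _ _ _ _ _ (l23 V))].
  rewrite (mulmxA (l12 V)) VQ // -[RHS]mulmxA -(mpi_V12Q23 mpi).
  by rewrite (mulmxA (l12 P)) PV.
rewrite (mulmxA (l23 V)) -(mpi_P12V23 mpi) -[LHS]mulmxA VQ // -[RHS]mulmxA.
by rewrite PV.
Qed.

Lemma maps_V23_flip :
  [/\ maps (l23 V) (ran (l12 Q *m l23 Q)) (ran (l13 Q *m l23 P)),
      maps (flip f2 f3) (ran (l13 Q *m l23 P)) (ran (l12 Q *m leg f3 f2 P))
    & maps flip12_3 (ran (l12 Q *m leg f3 f2 P)) (ran (l13 P *m l23 Q))].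
Proof.
split.
- apply: (@maps_ran _ _ _ _ _ (l23 V)).
  rewrite (mulmxA (l23 V)) (mpi_V23Q12 mpi) -[LHS]mulmxA VQ // -[RHS]mulmxA.
  by rewrite PV.
- apply: (@maps_ran _ _ _ _ _ (flip f2 f3)).
  rewrite (mulmxA (flip f2 f3)) flip_leg -[LHS]mulmxA flip_leg mulmxA.
  by rewrite !permE.
- apply: (@maps_ran _ _ _ _ _ flip12_3).
  rewrite (mulmxA flip12_3) flip12_3_leg -[LHS]mulmxA flip12_3_leg mulmxA /=.
  by rewrite mpi_P13Q23.
Qed.

Lemma maps_V23_flip_V12 :
  [/\ maps (l23 V) (ran (l13 P *m l23 Q)) (ran (leg f2 f1 Q *m l23 P)),
      maps (flip f1 f2) (ran (leg f2 f1 Q *m l23 P)) (ran (l13 P *m l12 Q))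
    & maps (l12 V) (ran (l13 P *m l12 Q)) (ran (l12 P *m l23 P))].
Proof.
split.
- apply: (@maps_ran _ _ _ _ _ (l23 V)).
  rewrite (mulmxA (l23 V)) (mpi_V23P13 mpi) -[LHS]mulmxA VQ // -[RHS]mulmxA.
  by rewrite PV.
- apply: (@maps_ran _ _ _ _ _ (flip f1 f2)).
  rewrite (mulmxA (flip f1 f2)) flip_leg -[LHS]mulmxA flip_leg mulmxA.
  by rewrite !permE /= mpi_Q12P13.
- apply: (@maps_ran _ _ _ _ _ (l12 V)).
  rewrite (mulmxA (l12 V)) (mpi_V12P13 mpi) -[LHS]mulmxA VQ //.
  by rewrite (mpi_P12P23 mpi) -[RHS]mulmxA PV.
Qed.

(** The three permutations on the right compose to the conjugation of V23 by the
flip of the first two factors, that is, to V13; what remains is the pentagon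
identity of V. *)
Lemma pentagon_flips v :
  l23 V *m (l12 V *m v) =
  l12 V *m (flip f1 f2 *m (l23 V *m (flip12_3 *m (flip f2 f3 *m (l23 V *m v)))))
  :> 'cV_(n * n * n).
Proof.
rewrite (mulmxA flip12_3) flip12_3_flip23 (mulmxA (flip f1 f2)) flip_leg !permE /=.
rewrite -(mulmxA (l13 V)) (mulmxA (flip f1 f2) (flip f1 f2)) flipK mul1mx.
by rewrite !mulmxA (mpi_pentagon mpi).
Qed.

Context (eps epsh : functional C n) (uni : unital V eps epsh).

Lemma V_intertwines x : x \in AL V ->
  let a02 := alpha02 V eps epsh in let a12 := alpha12 V eps in
  [/\ intertwines Q P V (alpha01 x *t 1%:M) (alpha01 x *t 1%:M),
      intertwines Q P V (1%:M *t alpha01 x) (a12 x *t 1%:M),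
      intertwines Q P V (1%:M *t a12 x) (1%:M *t a12 x)
    & intertwines Q P V (a02 x *t 1%:M) (1%:M *t a02 x)].
Proof.
move=> xB a02 a12; have xB' := AL_adj xB; rewrite /alpha01.
have xl_comm y : y \in AL V -> V *m (y *t 1%:M) = (y *t 1%:M) *m V.
  by move=> /memAL [w ->]; rewrite V_xll.
have a12_comm y : y \in AL V -> V *m (1%:M *t a12 y) = (1%:M *t a12 y) *m V.
  by move=> /memAL [w ->]; rewrite /a12 (alpha12_xl mpi uni) V_qrr.
have a02_comm y : V *m (a02 y *t 1%:M) = (1%:M *t a02 y) *m V.
  by rewrite /a02; have [w ->] := alpha02_pr mpi uni y; rewrite V_prl.
have [_ _ a12s] := alpha12_star_hom mpi uni.
have [_ _ a02s] := alpha02_star_antihom mpi uni.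
split; apply: partial_isometry_intertwines => //; rewrite ?adj_tens ?adjmx1.
- exact: xl_comm.
- exact: xl_comm.
- exact: (V_alpha12 mpi uni).
- by rewrite -a12s //; exact: (V_alpha12 mpi uni).
- exact: a12_comm.
- by rewrite -a12s //; apply: a12_comm.
- by rewrite -a02s //; apply: a02_comm.
Qed.

Lemma initial_final_pseudo_mult_unitary :
  let a02 := alpha02 V eps epsh in let a12 := alpha12 V eps in
  [/\ V^t* *m V = e_app (AL V) eps a12 a02,
      V *m V^t* = e_app (AL V) eps a02 alpha01
    & pseudo_mult_unitary (AL V) eps alpha01 a02 a12 V].
Proof.
move=> a02 a12; have EQ := initialp_e_app mpi uni; have EP := finalp_e_app mpi uni.
split; [exact: EQ|exact: EP|].
rewrite /pseudo_mult_unitary -EQ -EP; split.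
- by split; [exact: (AL_cstar mpi uni)|exact: (eps_faithful_positive mpi uni)].
- split; [exact: alpha01_star_hom|exact: (alpha02_star_antihom mpi uni)|].
  exact: (alpha12_star_hom mpi uni).
- split; [exact: (alpha01_alpha02 mpi uni)|exact: (alpha01_alpha12 mpi uni)|].
  exact: (alpha02_alpha12 mpi uni).
- exact: partial_isometry_unitary.
- split; [exact: V_intertwines|exact: maps_V12_V23|exact: maps_V23_flip| |].
  + exact: maps_V23_flip_V12.
  + by move=> v _; exact: pentagon_flips.
Qed.

End PseudoMultiplicative.

Theorem mainTheorem4 (R : realType) (n : nat) (V : 'M[R[i]]_(n * n))
    (eps epsh : functional R[i] n) :
  mult_partial_isometry V -> unital V eps epsh ->
  let N := AL V in
  let a01 := alpha01 in
  let a02 := alpha02 V eps epsh in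
  let a12 := alpha12 V eps in
  [/\ V^t* *m V = e_app N eps a12 a02,
      V *m V^t* = e_app N eps a02 a01
    & pseudo_mult_unitary N eps a01 a02 a12 V].
Proof. by move=> mpi uni; exact: (initial_final_pseudo_mult_unitary mpi uni). Qed.
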